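(* Let $S=\left\{\frac{n(3n-1)}{2}: n\in\mathbb{Z}\right\}$ denote the set of generalized pentagonal numbers. For any integer $s>1$ and any positive odd integer $\ell$ with $5\nmid\ell$, there exists some $i$ in the set \[ \{i\in 2\mathbb{Z}_{\ge0}+1:\ i\le 2^{s-1}-1,\ 2^r\ne 2^{s-1}-i-1\text{ for all } r=0,1,2,\dots,s-2\} \] such that the finite set \[ \left\{p\left(\frac{5^i\ell^2-\frac{4^s-1}{3}}{8}-4^s\cdot j\right): j\in S\right\} \] contains at least one odd element.
   Context: $p(n)$ denotes the partition function (the number of nonincreasing sequences of positive integers summing to $n$, with $p(0)=1$), given by $\sum_{n\ge0}p(n)q^n=\prod_{n\ge1}(1-q^n)^{-1}$; values of $p$ at arguments that are not non-negative integers are taken to be $0$ (equivalently, only those $j\in S$ for which the argument is non-negative are considered). *)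

(* Defs.v *)
From HB Require Import structures.
From mathcomp Require Import all_boot all_order all_algebra.

Set Implicit Arguments.
Unset Strict Implicit.
Unset Printing Implicit Defensive.

Import Order.TTheory GRing.Theory Num.Theory.

Definition is_partition (n : nat) (t : seq nat) : bool :=
  [&& sorted geq t, all (fun k => 0 < k) t & sumn t == n].

(* A sequence of positive integers with sum n has at most n terms, each at most
   n, so the finite type n.-bseq 'I_n.+1 contains all of them; npartP below. *)
Definition npart (n : nat) : nat :=
  #|[set t : n.-bseq 'I_n.+1 | is_partition n (map val t)]|.

Lemma npartP (n : nat) :
  exists ps : seq (seq nat),
    [/\ uniq ps, forall t, (t \in ps) = is_partition n t & size ps = npart n].
Proof.
pose A := [set t : n.-bseq 'I_n.+1 | is_partition n (map val t)].
exists [seq map val (t : n.-bseq 'I_n.+1) | t <- enum A]; split.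
- rewrite map_inj_uniq ?enum_uniq // => t u /(inj_map val_inj) /val_inj //.
- move=> t; apply/mapP/idP => [[u]|tP].
    by rewrite mem_enum inE => uP ->.
  have /and3P[_ pos_t /eqP sum_t] := tP.
  have le_size : size t <= n.
    rewrite -sum_t; elim: t pos_t {tP sum_t} => //= a t IH /andP[a0 /IH].
    by move=> h; rewrite -add1n leq_add.
  have lt_t : all (fun k => k < n.+1) t.
    apply/allP => k kt; rewrite ltnS -sum_t.
    elim: t kt {tP pos_t sum_t le_size} => //= a t IH.
    rewrite inE => /orP[/eqP->|/IH h]; first exact: leq_addr.
    exact: leq_trans h (leq_addl _ _).
  pose u := [seq inord k : 'I_n.+1 | k <- t].
  have size_u : size u <= n by rewrite size_map.
  have val_u : map val u = t.
    rewrite -map_comp -[RHS]map_id; apply/eq_in_map => k kt /=.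
    by rewrite inordK //; apply: (allP lt_t).
  by exists (Bseq size_u); rewrite ?mem_enum ?inE /= ?val_u.
- by rewrite size_map -cardE.
Qed.

Local Open Scope ring_scope.

(* The partition function extended by 0 to the rationals that are not
   nonnegative integers. *)
Definition partq (x : rat) : nat :=
  if x \is a Num.nat then npart (Num.truncn x) else 0%N.

Lemma partq_nat (n : nat) : partq n%:R = npart n.
Proof. by rewrite /partq natr_nat Num.Theory.natrK. Qed.

Definition pentagonal (j : rat) : Prop :=
  exists n : int, j = n%:~R * (3 * n%:~R - 1) / 2.

(* Main.v *)
Require Import Defs.
From HB Require Import structures.
From mathcomp Require Import all_boot all_order all_algebra.
From mathcomp Require Import boolp.
From mathcomp Require Import ring zify.

(** Put k = (4^s - 1)/3 and theta = sum of q^(x^2) over odd x > 0. By Euler,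
the inverse of the partition series is the pentagonal series P(q), and modulo 2
the cube of eta = q P(q^24) is theta(q^3). Hence the sum of p(N - 4^s j) over
j in S is, modulo 2, the coefficient of q^N in P^(4^s - 1) = P^(3k), which is
the coefficient of q^(8N + k) in theta^k. The exponent i = 2^(s-1) - 1 always
works: the coefficient of theta^k at 5^i l^2 is 1.

Indeed let T be the Hecke operator a(n) |-> a(5n) + a(n/5). In characteristic 2,
T^i and T_(5^i) coincide when i + 1 is a power of 2, so it suffices that
T^i theta^k = theta. The modular equation theta theta' = (theta + theta')^6,
with theta' = theta(q^5), is parametrized by theta = d(d+1)^5, theta' =
d^5(d+1), so that T acts on F_2[theta] through the trace of a genus 0
correspondence. Its effect on the binary digits of the exponents is controlled
by a weight (a combination of the Nicolas-Serre numbers n_3 and n_5), and the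
claim follows by induction on s from theta^(4k + 1) = theta (theta^k)^4. *)

Set Implicit Arguments.
Unset Strict Implicit.
Unset Printing Implicit Defensive.

Import Order.TTheory GRing.Theory Num.Theory.
Local Open Scope ring_scope.

Local Notation A := {poly 'F_2}.

(** * The trace from F_2[d] to F_2[y] *)

(** The obstacle is that the induction hypothesis does not apply to the inner factor: T turns theta
    F^4 into theta (S F)^4 for an operator S other than T. The two become comparable on square
    roots. For theta^k = theta H^2, T^h acts on H by h steps of one operator and S^(2h) by h steps
    of another; they differ by terms that fall one unit further than the 3 units of weight removed
    by each step. As H has weight at most 3 h, with h = 2^s - 1, the discrepancy after h steps has
    negative weight and is zero. Hence S^(2h) theta^k = theta. The trace is tied to the Hecke
    operator by a recurrence: the trace of x^k and the Hecke image of theta^k satisfy the same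
    relation of order six, given by the modular equation, and agree for k < 6. The modular equation
    comes from eta(q) eta(q^2) and eta(q) eta(q^5) modulo 2, which count solutions of x^2 + a y^2 =
    n for a = 2 and 5; involutions leave only solutions with a zero coordinate and a class that
    repeats the whole set at scale 9. *)

Lemma char2_F2 : 2%N \in [pchar 'F_2].
Proof. exact: pchar_Fp. Qed.

Lemma char2_poly : 2%N \in [pchar {poly 'F_2}].
Proof. by rewrite pchar_poly char2_F2. Qed.

Lemma F2P (a : 'F_2) : a = 0 \/ a = 1.
Proof. by case: a => [[|[|n]]] // ?; [left|right]; apply: val_inj. Qed.

Section Char2.
Variables (R : comNzRingType) (ch : 2%N \in [pchar R]).
Implicit Types x y z : R.

(* Reduces identities in characteristic 2 to ones that [ring] proves over Z. *)
Lemma eq_mod2 x y z : x + y = z + z -> x = y.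
Proof. by rewrite (addrr_pchar2 ch) => /eqP; rewrite addr_eq0 (oppr_pchar2 ch) => /eqP. Qed.

Lemma sqrD2 x y : (x + y) ^+ 2 = x ^+ 2 + y ^+ 2.
Proof. by rewrite (exprDn_pchar _ _ (_ : [pchar R].-nat 2%N)) // pnatE. Qed.

Lemma sum_sqr2 (I : Type) (r : seq I) (F : I -> R) :
  (\sum_(i <- r) F i) ^+ 2 = \sum_(i <- r) F i ^+ 2.
Proof.
elim: r => [|i r IH]; first by rewrite !big_nil expr0n.
by rewrite !big_cons sqrD2 IH.
Qed.
End Char2.

(** Reduction of d^n by d^6 = d^5 + y, where ['X] stands for y; these are the values of [Tau] on
    powers of d. *)
Fixpoint tau (n : nat) : A :=
  if n is p.+1 then
    if p is m.+1.+4 then tau p + 'X * tau m else (p == 4)%:R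
  else 0.

Arguments tau : simpl never.

Lemma tau_small :
  (((tau 0 = 0) * (tau 1 = 0) * (tau 2 = 0) * (tau 3 = 0) * (tau 4 = 0)) *
   ((tau 5 = 1) * (tau 6 = 1) * (tau 7 = 1) * (tau 8 = 1) * (tau 9 = 1) * (tau 10 = 1)))%type.
Proof. by rewrite /tau /= !mulr0 !addr0. Qed.

Lemma tauS n : tau n.+1.+1.+4 = tau n.+1.+4 + 'X * tau n.
Proof. by []. Qed.

Opaque tau.

(* The coefficient of 'X^5 when {poly 'F_2} (indeterminate d) is expanded on the
   basis 1, .., 'X^5 over F_2[y], with y acting as [Yd] below. As the derivative
   of [Yd] is d^4, this is the trace of P / d^4. *)
Definition Tau (P : A) : A := \sum_(i < size P) P`_i *: tau i.

Lemma Tau_widen (P : A) n : (size P <= n)%N -> Tau P = \sum_(i < n) P`_i *: tau i.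
Proof.
move=> le; rewrite /Tau (big_ord_widen _ (fun i => P`_i *: tau i) le) big_mkcond /=.
apply: eq_bigr => i _; case: ltnP => // h.
by rewrite nth_default // scale0r.
Qed.

Fact Tau_is_linear : linear Tau.
Proof.
move=> a P Q; set n := maxn (size P) (size Q).
have sP : (size P <= n)%N by rewrite leq_maxl.
have sQ : (size Q <= n)%N by rewrite leq_maxr.
have sPQ : (size (a *: P + Q)%R <= n)%N.
  by rewrite (leq_trans (size_polyD _ _)) // geq_max sQ (leq_trans (size_scale_leq _ _)).
rewrite !(Tau_widen (n := n)) // scaler_sumr -big_split /=; apply: eq_bigr => i _.
by rewrite coefD coefZ scalerDl scalerA.
Qed.
HB.instance Definition _ := GRing.isLinear.Build 'F_2 A A _ Tau Tau_is_linear.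

Lemma Tau_Xn n : Tau 'X^n = tau n.
Proof.
rewrite (Tau_widen (n := n.+1)) ?size_polyXn // big_ord_recr /= coefXn eqxx scale1r.
rewrite big1 ?add0r // => i _; rewrite coefXn.
by rewrite (ltn_eqF (ltn_ord i)) scale0r.
Qed.

Lemma poly_ind_lin (Q : A -> Prop) :
  Q 0 -> (forall n, Q 'X^n) -> (forall P P', Q P -> Q P' -> Q (P + P')) ->
  forall P, Q P.
Proof.
move=> Q0 QX QD P; rewrite -[P]coefK poly_def.
apply: big_ind => // i _; case: (F2P P`_i) => ->; first by rewrite scale0r.
by rewrite scale1r.
Qed.

(* On the curve XY = (X + Y)^6: here X + Y = d(d + 1). *)
Definition Yd : A := 'X^6 + 'X^5.
Definition Xd : A := 'X * ('X + 1) ^+ 5.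

Lemma Tau_Y P : Tau (Yd * P) = 'X * Tau P.
Proof.
elim/poly_ind_lin: P => [|n|P Q IP IQ]; first by rewrite mulr0 linear0 mulr0.
  rewrite /Yd mulrDl -!exprD linearD /= !Tau_Xn.
  rewrite -[(6 + n)%N]/(n.+1.+1.+4) -[(5 + n)%N]/(n.+1.+4) tauS.
  by rewrite addrAC (addrr_pchar2 char2_poly) add0r.
by rewrite !mulrDr !linearD /= IP IQ mulrDr.
Qed.

(** In characteristic 2 the trace of a square is the square of the trace, and P^2 / d^4 is the
    square of d^2 P / d^4. On monomials this compares the recurrence of [tau] with its Frobenius
    image d^12 = d^10 + y^2. *)
Lemma Tau_sqr P : Tau (P ^+ 2) = Tau ('X^2 * P) ^+ 2.
Proof.
elim/poly_ind_lin: P => [|n|P Q IP IQ].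
- by rewrite mulr0 linear0 !expr0n linear0.
- rewrite -exprM -exprD !Tau_Xn.
  elim/ltn_ind: n => n IH.
  case: n IH => [|[|[|[|[|[|n]]]]]] IH; rewrite ?(tau_small, expr0n, expr1n) //.
  have e : (forall m, tau (12 + m) = tau (10 + m) + 'X ^+ 2 * tau m)%R.
    move=> m; rewrite -!Tau_Xn.
    have -> : 'X^(12 + m) = 'X^(10 + m) + Yd * (Yd * 'X^m) :> A.
      apply: (eq_mod2 char2_poly (z := 'X^(12 + m) + 'X^(10 + m) + 'X^(11+m))).
      by rewrite /Yd !exprD; ring.
    by rewrite linearD /= !Tau_Y expr2 mulrA.
  have -> : (n.+1.+1.+4 * 2 = 12 + n * 2)%N by lia.
  rewrite e (_ : 10 + n * 2 = (n.+1.+4) * 2)%N; last by lia.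
  rewrite IH // IH //; last lia.
  have -> : (2 + n.+1.+1.+4 = (2 + n).+1.+1.+4)%N by lia.
  rewrite tauS [RHS](sqrD2 char2_poly) exprMn.
  by congr (_ + _); congr (tau _ ^+ 2); lia.
- by rewrite mulrDr !(sqrD2 char2_poly) !linearD /= IP IQ (sqrD2 char2_poly).
Qed.

(** From d = y / d^4 + d^2 one gets d P^2 = y (P / d^2)^2 + (d P)^2, and [Tau_sqr] handles both
    squares. For P = 1 and P = d the quotient P / d^2 is not a polynomial, so these two cases are
    computed. *)
Lemma Tau_oddsqr P : Tau ('X * P ^+ 2) = 'X * Tau P ^+ 2 + Tau ('X^3 * P) ^+ 2.
Proof.
elim/poly_ind_lin: P => [|n|P Q IP IQ].
- by rewrite expr0n !mulr0 linear0 expr0n mulr0 addr0.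
- case: n => [|[|n]].
  + have -> : 'X * ('X^0) ^+ 2 = 'X^1 :> A by rewrite expr1n mulr1.
    by rewrite mulr1 (Tau_Xn 0) !Tau_Xn !tau_small expr0n mulr0 addr0.
  + by rewrite expr1 -exprS -exprSr !Tau_Xn -['X]expr1 Tau_Xn !tau_small expr0n mulr0 addr0.
  have -> : 'X * ('X^(n.+2)) ^+ 2 = Yd * 'X^n ^+ 2 + ('X^3 * 'X^n) ^+ 2 :> A.
    apply: (eq_mod2 char2_poly (z := ('X^3 * 'X^n) ^+ 2 + 'X^5 * 'X^n ^+ 2)).
    by rewrite /Yd !exprS; ring.
  rewrite linearD /= Tau_Y !Tau_sqr; congr ('X * Tau _ ^+ 2 + Tau _ ^+ 2).
    by rewrite -exprD.
  by rewrite mulrA -!exprD; congr ('X^_); lia.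
- rewrite mulrDr !(sqrD2 char2_poly) !mulrDr !linearD /= !(sqrD2 char2_poly) IP IQ.
  by ring.
Qed.

(** Two rounds of halving, with one formula for each residue modulo 4 of the exponent of d; this is
    how base 4 digits enter. *)
Lemma Tau_pow4 (P : A) :
  [/\ Tau (P ^+ 4) = Tau ('X^3 * P) ^+ 4,
      Tau ('X * P ^+ 4) =
        'X * Tau ('X^2 * P) ^+ 4 + 'X^2 * Tau ('X * P) ^+ 4 + Tau ('X^4 * P) ^+ 4,
      Tau ('X^2 * P ^+ 4) = 'X^2 * Tau ('X * P) ^+ 4 + Tau ('X^4 * P) ^+ 4 &
      Tau ('X^3 * P ^+ 4) =
        'X^3 * Tau P ^+ 4 + 'X * Tau ('X^3 * P) ^+ 4 + Tau ('X^4 * P) ^+ 4].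
Proof.
have e4 (z : A) : z ^+ 4 = (z ^+ 2) ^+ 2 by rewrite -exprM.
have e0 : Tau ('X^2 * P ^+ 2) = Tau ('X^3 * P) ^+ 2.
  by rewrite -exprMn Tau_sqr (mulrA 'X^2) -exprSr.
have e1 : Tau ('X^3 * P ^+ 2) = 'X * Tau ('X * P) ^+ 2 + Tau ('X^4 * P) ^+ 2.
  by rewrite exprS -mulrA -exprMn Tau_oddsqr (mulrA 'X^3) -exprSr.
have e2 : Tau ('X^2 * (P ^+ 2) ^+ 2) = 'X^2 * Tau ('X * P) ^+ 4 + Tau ('X^4 * P) ^+ 4.
  by rewrite -exprMn Tau_sqr (mulrA 'X^2) -exprSr e1 (sqrD2 char2_poly) exprMn -!e4.
split; rewrite (e4 P).
- by rewrite Tau_sqr e0 -e4.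
- by rewrite Tau_oddsqr e1 Tau_sqr (sqrD2 char2_poly); ring.
- exact: e2.
- have -> : 'X^3 * P ^+ 2 ^+ 2 = 'X * ('X * P ^+ 2) ^+ 2 :> A by ring.
  rewrite Tau_oddsqr Tau_oddsqr.
  have -> : 'X^3 * ('X * P ^+ 2) = ('X^2 * P) ^+ 2 :> A by ring.
  rewrite Tau_sqr (mulrA 'X^2) -exprD !(sqrD2 char2_poly).
  by ring.
Qed.

(** * Weights *)

(* In terms of the Nicolas-Serre numbers, [wt d] is 2 n_3 + 3 n_5 for the odd
   exponent 2d + 1. *)
Definition w4 (j : nat) : nat := nth 0%N [:: 0; 2; 3; 5]%N j.

Fixpoint wt_rec (fuel n : nat) : nat :=
  if fuel is f.+1 then (w4 (n %% 4) + 2 * wt_rec f (n %/ 4))%N else 0%N.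

Definition wt (n : nat) : nat := wt_rec n n.

Lemma wt_recE f n : (n <= f)%N -> wt_rec f n = wt n.
Proof.
rewrite /wt; elim/ltn_ind: n f => -[|n] IH [|f] // le.
  by elim: f {le} => //= f ->.
rewrite /=; congr (_ + 2 * _)%N.
have h : (n.+1 %/ 4 <= n)%N by lia.
by rewrite !IH //; lia.
Qed.

Lemma wtE k j : (j < 4)%N -> wt (4 * k + j) = (w4 j + 2 * wt k)%N.
Proof.
move=> j4; rewrite -(wt_recE (f := (4 * k + j).+1)) //=.
have -> : ((4 * k + j) %% 4 = j)%N by lia.
have -> : ((4 * k + j) %/ 4 = k)%N by lia.
by rewrite wt_recE //; lia.
Qed.

(** Raising a digit below 3 costs at most 2; a carry drops a final 3 of weight 5 and adds at most 2
    * 2 through the higher digits. *)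
Lemma wtS n : (wt n.+1 <= wt n + 2)%N.
Proof.
elim/ltn_ind: n => n IH.
rewrite (divn_eq n 4) mulnC; have := ltn_pmod n (isT : 0 < 4)%N.
case E: (n %% 4)%N => [|[|[|[|j]]]] // _.
- by rewrite -addnS !wtE // /w4 /=; lia.
- by rewrite -addnS !wtE // /w4 /=; lia.
- by rewrite -addnS !wtE // /w4 /=; lia.
- have -> : (4 * (n %/ 4) + 3).+1 = (4 * (n %/ 4).+1 + 0)%N by lia.
  by rewrite !wtE // /w4 /=; have := IH (n %/ 4)%N; lia.
Qed.

Definition wle (P : A) (m : int) : Prop := forall k, P`_k != 0 -> (wt k)%:Z <= m.

Lemma wle0 m : wle 0 m.
Proof. by move=> k; rewrite coef0 eqxx. Qed.

Lemma wleD P Q m : wle P m -> wle Q m -> wle (P + Q) m.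
Proof.
move=> hP hQ k; rewrite coefD.
by case: (eqVneq P`_k 0) => [->|/hP //]; rewrite add0r => /hQ.
Qed.

Lemma wle_sum (I : eqType) (r : seq I) (F : I -> A) m :
  (forall i, i \in r -> wle (F i) m) -> wle (\sum_(i <- r) F i) m.
Proof.
move=> h; rewrite big_seq; apply: (big_ind (fun P => wle P m)) => //; first exact: wle0.
by move=> P Q; exact: wleD.
Qed.

Lemma wle_trans P m n : wle P m -> m <= n -> wle P n.
Proof. by move=> h le k /h /le_trans; apply. Qed.

Lemma wle_Xn k : wle 'X^k (wt k)%:Z.
Proof. by move=> i; rewrite coefXn; case: (eqVneq i k) => [-> //|_]; rewrite eqxx. Qed.

Arguments wle_Xn : clear implicits.

Lemma wle_mulX P m : wle P m -> wle ('X * P) (m + 2).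
Proof.
move=> h [|k]; rewrite coefXM ?eqxx //= => /h.
by have := wtS k; lia.
Qed.

Lemma wle_neg P m : m < 0 -> wle P m -> P = 0.
Proof.
move=> m0 h; apply/polyP => k; rewrite coef0; apply/eqP/negPn/negP => /h.
by move=> /le_lt_trans/(_ m0).
Qed.

Lemma poly_sumE (P : A) : P = \sum_(k <- [seq k <- iota 0 (size P) | P`_k != 0]) 'X^k.
Proof.
rewrite big_filter -[LHS]coefK poly_def -(big_mkord xpredT (fun i => P`_i *: 'X^i)).
rewrite /index_iota subn0 [RHS]big_mkcond /=; apply: eq_bigr => i _.
by case: (F2P P`_i) => ->; rewrite ?eqxx ?scale0r ?oner_eq0 ?scale1r.
Qed.

Lemma wle_pow4 P m a : (a < 4)%N -> wle P m -> wle ('X^a * P ^+ 4) ((w4 a)%:Z + 2 * m).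
Proof.
move=> a4 h; rewrite [P in P ^+ 4]poly_sumE (exprM _ 2 2) !(sum_sqr2 char2_poly).
rewrite mulr_sumr; apply: wle_sum => k; rewrite mem_filter => /andP[/h hk _].
have -> : 'X^a * ('X^k ^+ 2) ^+ 2 = 'X^(4 * k + a) :> A.
  by rewrite -!exprM -exprD; congr ('X^_); lia.
by apply: (wle_trans (wle_Xn _)); rewrite wtE //; lia.
Qed.

Lemma mulrn_odd (P : A) n : P *+ n = P *+ odd n.
Proof. by rewrite -{1}(odd_double_half n) mulrnDr -addnn mulrnDr (addrr_pchar2 char2_poly) addr0. Qed.

(** Cancellation of pairs is essential for the certificate below: [coords 0 1 0] contains the index
    11 twice, and a single occurrence would break the bound. *)
Lemma wle_sum_odd (r : seq nat) (F : nat -> A) m :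
  {in r, forall c, odd (count_mem c r) -> wle (F c) m} -> wle (\sum_(c <- r) F c) m.
Proof.
move=> h; rewrite -big_undup_iterop_count.
apply: wle_sum => c; rewrite mem_undup => /h {}h.
rewrite -[iterop _ _ _ _]/(F c *+ count_mem c r) mulrn_odd.
by case: (odd _) h => [/(_ isT)|_] //; exact: wle0.
Qed.

(** * Traces of the monomials d^i x^k and their weights *)

Definition tpow (i k : nat) : A := Tau ('X^i * Xd ^+ k).

Lemma XdE : Xd = 'X + 'X^2 + 'X^5 + 'X^6.
Proof.
apply: (eq_mod2 char2_poly (z := 'X + 3 * 'X^2 + 5 * 'X^3 + 5 * 'X^4 + 3 * 'X^5 + 'X^6)).
by rewrite /Xd; ring.
Qed.

Lemma tpow_shift i k : tpow i.+1.+1.+4 k = tpow i.+1.+4 k + 'X * tpow i k.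
Proof.
rewrite /tpow -Tau_Y -linearD /=; congr Tau.
apply: (eq_mod2 char2_poly (z := 'X^(i.+1.+1.+4) * Xd ^+ k + 'X^(i.+1.+4) * Xd ^+ k)).
by rewrite /Yd !exprS; ring.
Qed.

(** Row 3 is d^3 (d + 1)^15, and all binomial coefficients of 15 are odd. *)
Definition Xexp (j : nat) : seq nat :=
  nth [::] [:: [:: 0]; [:: 1; 2; 5; 6]; [:: 2; 4; 10; 12]; iota 3 16]%N j.

Lemma XexpE j : (j < 4)%N -> Xd ^+ j = \sum_(n <- Xexp j) 'X^n.
Proof.
case: j => [|[|[|[|j]]]] // _; rewrite /Xexp /= !big_cons big_nil.
- by rewrite addr0.
- by rewrite XdE; ring.
- by rewrite XdE !(sqrD2 char2_poly) -!exprM; ring.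
- rewrite exprS XdE !(sqrD2 char2_poly) -!exprM; ring.
Qed.

(** The pair (a, e) stands for y^a times the fourth power of [tpow e k]; the four rows transcribe
    [Tau_pow4] for P = d^m x^k. *)
Definition texp (i : nat) : seq (nat * nat) :=
  let m := (i %/ 4)%N in
  nth [::] [:: [:: (0, m + 3)]; [:: (1, m + 2); (2, m + 1); (0, m + 4)];
    [:: (2, m + 1); (0, m + 4)]; [:: (3, m); (1, m + 3); (0, m + 4)]]%N (i %% 4).

Lemma texpE i k :
  tpow i (4 * k) = \sum_(p <- texp i) 'X^(p.1) * tpow p.2 k ^+ 4.
Proof.
have [h0 h1 h2 h3] := Tau_pow4 ('X^(i %/ 4) * Xd ^+ k).
have e : 'X^i * Xd ^+ (4 * k) = 'X^(i %% 4) * ('X^(i %/ 4) * Xd ^+ k) ^+ 4.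
  rewrite (mulnC 4) exprM; move: (Xd ^+ k) => Z.
  by rewrite {1}(divn_eq i 4) exprD (exprM _ _ 4) exprMn; ring.
have s n : tpow (i %/ 4 + n) k = Tau ('X^n * ('X^(i %/ 4) * Xd ^+ k)).
  by rewrite /tpow (addnC _ n) exprD -mulrA.
rewrite {1}/tpow e /texp; have := ltn_pmod i (isT : 0 < 4)%N.
case: (i %% 4)%N => [|[|[|[|j]]]] // _; rewrite /= !big_cons big_nil /= ?s addr0.
- by rewrite !mul1r h0.
- by rewrite mul1r -addrA in h1 *.
- by rewrite mul1r h2.
- by rewrite mul1r h3 -addrA.
Qed.

(* [gen c k], c < 12, spans the [tpow n k], n < 11, with coordinates [coord n];
   the weight of [gen c k] exceeds that of k by at most [gdeg c]. These degrees
   were found by computer; [coords_ok] checks that they propagate from k to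
   4k + j. The term 'X^k of [gen 5 k] records that [tpow 5] is the identity up to
   lower weight. *)
Definition genrow (c : nat) : seq nat :=
  nth [::] [:: [:: 0]; [:: 1; 2]; [:: 4]; [:: 1]; [:: 3]; [:: 5]]%N c.

Definition gen (c k : nat) : A :=
  if (c < 6)%N then \sum_(i <- genrow c) tpow i k + (c == 5)%:R * 'X^k
  else nth 0 [:: 'X * tpow 0 k; 'X * (tpow 1 k + tpow 2 k); 'X * tpow 1 k;
    'X * tpow 3 k; 'X * tpow 4 k; 'X^k] (c - 6).

Definition gdeg (c : nat) : int :=
  nth 0 [:: - 4; - 4; - 4; - 3; - 2; - 2; - 2; - 2; - 1; 0; - 2; 0] c.

Definition coord (n : nat) : seq nat :=
  nth [::] [:: [:: 0]; [:: 3]; [:: 1; 3]; [:: 4]; [:: 2]; [:: 5; 11]; [:: 5; 11; 6]; [:: 5; 11; 6; 8];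
    [:: 5; 11; 6; 7]; [:: 5; 11; 6; 7; 9]; [:: 5; 11; 6; 7; 9; 10]]%N n.

Lemma coordE n k : (n < 11)%N -> tpow n k = \sum_(c <- coord n) gen c k.
Proof.
have e (x y : A) : x + y + y = x by rewrite -addrA (addrr_pchar2 char2_poly) addr0.
have e5 : tpow 5 k = gen 5 k + gen 11 k.
  by rewrite /gen /genrow /= big_cons big_nil addr0 mul1r e.
have e6 : tpow 6 k = gen 5 k + gen 11 k + gen 6 k by rewrite tpow_shift e5.
have e7 : tpow 7 k = gen 5 k + gen 11 k + gen 6 k + gen 8 k by rewrite tpow_shift e6.
have e8 : tpow 8 k = gen 5 k + gen 11 k + gen 6 k + gen 7 k.
  have -> : gen 7 k = gen 8 k + 'X * tpow 2 k by rewrite /gen /= mulrDr.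
  by rewrite tpow_shift e7 addrA.
case: n => [|[|[|[|[|[|[|[|[|[|[|n]]]]]]]]]]] // _; rewrite /coord /= !big_cons big_nil addr0.
- by rewrite /gen /= big_cons big_nil mul0r !addr0.
- by rewrite /gen /= big_cons big_nil mul0r !addr0.
- by rewrite /gen /= !big_cons big_nil !mul0r !addr0 addrAC (addrr_pchar2 char2_poly) add0r.
- by rewrite /gen /= big_cons big_nil mul0r !addr0.
- by rewrite /gen /= big_cons big_nil mul0r !addr0.
- by rewrite e5.
- by rewrite e6 -!addrA.
- by rewrite e7 -!addrA.
- by rewrite e8 -!addrA.
- by rewrite tpow_shift e8 -!addrA.
- by rewrite tpow_shift tpow_shift e8 -!addrA.
Qed.

Definition terms (c j a : nat) : seq nat :=
  [seq p.2 | p <- flatten [seq texp (i + n) | i <- genrow c, n <- Xexp j] & p.1 == a].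

Definition coords (c j a : nat) : seq nat :=
  flatten (map coord (terms c j a)) ++ (if (c == 5) && (j == a) then [:: 11%N] else [::]).

(** As [wt (4 * k + j)] is [w4 j + 2 * wt k], a summand y^a g^4 with g bounded by [wt k + gdeg b]
    fits the bound [wt (4 * k + j) + gdeg c] when the tested inequality holds. *)
Lemma coords_ok :
  all (fun c => all (fun j => all (fun a => all (fun e => e < 11)%N (terms c j a) &&
    all (fun b => odd (count_mem b (coords c j a)) ==>
       (b < 12)%N && ((w4 a)%:Z + 2 * gdeg b <= (w4 j)%:Z + gdeg c))
     (coords c j a))
    (iota 0 4)) (iota 0 4)) (iota 0 6).
Proof. by vm_compute. Qed.

Lemma pow4_sum (I : Type) (r : seq I) (F : I -> A) :
  (\sum_(i <- r) F i) ^+ 4 = \sum_(i <- r) F i ^+ 4.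
Proof.
by rewrite (exprM _ 2 2) !(sum_sqr2 char2_poly); apply: eq_bigr => i _; rewrite -exprM.
Qed.

Lemma pow4D (x y : A) : (x + y) ^+ 4 = x ^+ 4 + y ^+ 4.
Proof. by rewrite !(exprM _ 2 2) !(sqrD2 char2_poly). Qed.

Lemma tpow_step i j k : (j < 4)%N ->
  tpow i (4 * k + j) = \sum_(p <- flatten [seq texp (i + n) | n <- Xexp j]) 'X^(p.1) * tpow p.2 k ^+ 4.
Proof.
move=> j4; rewrite /tpow (addnC (4 * k)%N) exprD (XexpE j4) mulrA mulr_sumr mulr_suml linear_sum /=.
rewrite big_flatten big_map; apply: eq_bigr => n _.
by rewrite -exprD -/(tpow _ _) texpE.
Qed.

Lemma texp_lt4 i : all (fun p => p.1 < 4)%N (texp i).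
Proof.
rewrite /texp; have := ltn_pmod i (isT : 0 < 4)%N.
by case: (i %% 4)%N => [|[|[|[|m]]]].
Qed.

(** Terms are collected by the power of y before the fourth power is taken, so that equal ones can
    cancel inside one sum. *)
Lemma row_step c j k : (j < 4)%N ->
  \sum_(i <- genrow c) tpow i (4 * k + j) =
  \sum_(a <- iota 0 4) 'X^a * (\sum_(e <- terms c j a) tpow e k) ^+ 4.
Proof.
move=> j4; pose F (p : nat * nat) := 'X^(p.1) * tpow p.2 k ^+ 4.
set ts := flatten [seq texp (i + n) | i <- genrow c, n <- Xexp j].
transitivity (\sum_(p <- ts) F p).
  rewrite /ts big_flatten big_allpairs_dep /=; apply: eq_bigr => i _.
  by rewrite tpow_step // big_flatten big_map.
transitivity (\sum_(a <- iota 0 4) \sum_(p <- ts | p.1 == a) F p).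
  rewrite (exchange_big_dep xpredT) // big_seq [RHS]big_seq; apply: eq_bigr => p hp.
  have p4 : p.1 \in iota 0 4.
    case/flattenP: hp => s /allpairsPdep[i [n [_ _ ->]]].
    by move/(allP (texp_lt4 _)); rewrite mem_iota.
  rewrite big_mkcond (bigD1_seq p.1 p4) ?iota_uniq //= eqxx big1 ?addr0 // => a.
  by rewrite eq_sym => /negbTE ->.
apply: eq_bigr => a _; rewrite pow4_sum mulr_sumr big_map big_filter.
by apply: eq_bigr => p /eqP <-.
Qed.

Lemma gen_step c j k : (c < 6)%N -> (j < 4)%N ->
  gen c (4 * k + j) = \sum_(a <- iota 0 4) 'X^a * (\sum_(b <- coords c j a) gen b k) ^+ 4.
Proof.
move=> c6 j4; have /allP/(_ c) := coords_ok; rewrite mem_iota c6 => /(_ isT).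
move=> /allP/(_ j); rewrite mem_iota j4 => /(_ isT)/allP ok.
rewrite {1}/gen c6 row_step //.
have -> : (c == 5)%:R * 'X^(4 * k + j) =
    \sum_(a <- iota 0 4) 'X^a * ((c == 5) && (j == a))%:R * 'X^k ^+ 4 :> A.
  case: (c == 5)%N; last by rewrite mul0r big1 // => a _; rewrite mulr0 mul0r.
  rewrite (bigD1_seq j) ?mem_iota ?iota_uniq //= eqxx mulr1 mul1r big1 ?addr0.
    by rewrite -exprM -exprD; congr ('X^_); lia.
  by move=> a /negbTE; rewrite eq_sym => ->; rewrite mulr0 mul0r.
rewrite -big_split /= big_seq [RHS]big_seq; apply: eq_bigr => a /ok /andP[/allP lt11 _].
rewrite /coords big_cat /= pow4D mulrDr -mulrA.
congr (_ * _ + _ * _).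
  rewrite big_flatten big_map; congr (_ ^+ _).
  by rewrite big_seq [RHS]big_seq; apply: eq_bigr => e /lt11 /coordE ->.
case: (_ && _); first by rewrite big_cons big_nil addr0 mul1r.
by rewrite big_nil expr0n mul0r.
Qed.

Lemma gen0 c : (c < 6)%N -> gen c 0 = 0.
Proof.
rewrite /gen /tpow => c6; rewrite c6.
case: c c6 => [|[|[|[|[|[|c]]]]]] // _; rewrite /genrow /= !big_cons big_nil /= ?mulr1 !Tau_Xn !tau_small.
all: by rewrite ?mul0r ?mul1r ?addr0 // (addrr_pchar2 char2_poly).
Qed.

(** Generators 6 to 10 are y times the generators 0, 1, 3, 4, 2, and [wle_mulX] charges 2 for y. *)
Lemma gen_wle_of6 k :
  (forall c, (c < 6)%N -> wle (gen c k) ((wt k)%:Z + gdeg c)) ->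
  forall c, (c < 12)%N -> wle (gen c k) ((wt k)%:Z + gdeg c).
Proof.
move=> IH6.
have t0E : tpow 0 k = gen 0 k by rewrite /gen /= big_cons big_nil mul0r !addr0.
have t1E : tpow 1 k = gen 3 k by rewrite /gen /= big_cons big_nil mul0r !addr0.
have t12E : tpow 1 k + tpow 2 k = gen 1 k by rewrite /gen /= !big_cons big_nil mul0r !addr0.
have t3E : tpow 3 k = gen 4 k by rewrite /gen /= big_cons big_nil mul0r !addr0.
have t4E : tpow 4 k = gen 2 k by rewrite /gen /= big_cons big_nil mul0r !addr0.
move=> c; case: (ltnP c 6) => [/IH6 //|].
case: c => [|[|[|[|[|[|[|[|[|[|[|[|c]]]]]]]]]]]] // _ _.
- by apply: (wle_trans (wle_mulX (m := (wt k)%:Z - 4) _)); rewrite ?t0E ?/gdeg /=; [exact: IH6|lia].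
- by apply: (wle_trans (wle_mulX (m := (wt k)%:Z - 4) _)); rewrite ?t12E ?/gdeg /=; [exact: IH6|lia].
- by apply: (wle_trans (wle_mulX (m := (wt k)%:Z - 3) _)); rewrite ?t1E ?/gdeg /=; [exact: IH6|lia].
- by apply: (wle_trans (wle_mulX (m := (wt k)%:Z - 2) _)); rewrite ?t3E ?/gdeg /=; [exact: IH6|lia].
- by apply: (wle_trans (wle_mulX (m := (wt k)%:Z - 4) _)); rewrite ?t4E ?/gdeg /=; [exact: IH6|lia].
- by rewrite /gen /gdeg /= addr0; exact: wle_Xn.
Qed.

Lemma gen_wle6 c k : (c < 6)%N -> wle (gen c k) ((wt k)%:Z + gdeg c).
Proof.
elim/ltn_ind: k c => k IH c c6.
have [->|k0] := posnP k; first by rewrite gen0 //; exact: wle0.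
have j4 := ltn_pmod k (isT : 0 < 4)%N.
have ek : k = (4 * (k %/ 4) + k %% 4)%N by rewrite mulnC -divn_eq.
set k' := (k %/ 4)%N in ek; set j := (k %% 4)%N in j4 ek.
have lt : (k' < k)%N by rewrite /k'; lia.
have {}IH := gen_wle_of6 (fun b => @IH k' lt b).
have /allP/(_ c) := coords_ok; rewrite mem_iota c6 => /(_ isT).
move=> /allP/(_ j); rewrite mem_iota j4 => /(_ isT)/allP ok.
rewrite ek gen_step // wtE //.
apply: wle_sum => a ha; have /andP[lt11 /allP hb] := ok a ha.
have a4 : (a < 4)%N by move: ha; rewrite mem_iota.
(* The floor is the largest admissible degree; rounding loses nothing, since the degrees [gdeg b]
   are integers. *)
have := wle_pow4 (m := (wt k')%:Z + (((w4 j)%:Z + gdeg c - (w4 a)%:Z) %/ 2)%Z) a4.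
move=> /(_ (\sum_(b <- coords c j a) gen b k')) h.
refine (wle_trans (h _) _); last by lia.
apply: wle_sum_odd => b hbin hodd.
have := hb b hbin; rewrite hodd /= => /andP[b12 le].
by apply: (wle_trans (IH b b12)); lia.
Qed.

Lemma gen_wle c k : (c < 12)%N -> wle (gen c k) ((wt k)%:Z + gdeg c).
Proof. by apply: gen_wle_of6 => b; exact: gen_wle6. Qed.

(** * The operators and their nilpotence *)

Definition trop (G H : A) : A := Tau (G * (H \Po Xd)).

Fact trop_is_linear G : linear (trop G).
Proof. by move=> a H K; rewrite /trop comp_polyD comp_polyZ mulrDr -scalerAr linearP. Qed.
HB.instance Definition _ G := GRing.isLinear.Build 'F_2 A A _ (trop G) (trop_is_linear G).

Lemma trop_Xn G k : trop G 'X^k = Tau (G * Xd ^+ k).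
Proof. by rewrite /trop comp_Xn_poly. Qed.

Lemma trop_wle G d :
  (forall k, wle (Tau (G * Xd ^+ k)) ((wt k)%:Z + d)) ->
  forall H m, wle H m -> wle (trop G H) (m + d).
Proof.
move=> hG H m hH; rewrite [H]poly_sumE linear_sum.
apply: wle_sum => k; rewrite mem_filter => /andP[/hH hk _].
by rewrite /= trop_Xn; apply: (wle_trans (hG k)); rewrite lerD2r.
Qed.

(* [opT] is the Hecke operator at 5 on F_2[theta], and [opS] is its conjugate by
   the fourth root of theta (see [opT_mulXpow4]). On odd polynomials, which are
   'X times squares, opS^2 is given by [opQ \o opR] and [opT] by [opS2]: these
   agree up to lower weight. *)
Definition opT := trop 'X^4.
Definition opS := trop ('X^3 * ('X + 1)).
Definition opR := trop ('X^4 * ('X + 1) ^+ 3).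
Definition opQ := trop 'X.
Definition opS2 := trop ('X^2 + 'X^4).

(** Here d^4 x = y (d + 1)^4, so y leaves the trace and a fourth power remains. *)
Lemma opT_mulXpow4 F : opT ('X * F ^+ 4) = 'X * opS F ^+ 4.
Proof.
rewrite /opT /opS /trop rmorphM rmorphXn /= comp_polyX; move: (F \Po Xd) => P.
have -> : 'X^4 * (Xd * P ^+ 4) = Yd * (('X + 1) * P) ^+ 4 :> A by rewrite /Xd /Yd; ring.
by have [h _ _ _] := Tau_pow4 (('X + 1) * P); rewrite Tau_Y h (mulrA 'X^3).
Qed.

Lemma opT_mulXsqr H : opT ('X * H ^+ 2) = 'X * opS2 H ^+ 2.
Proof.
rewrite /opT /opS2 /trop rmorphM rmorphXn /= comp_polyX; move: (H \Po Xd) => P.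
have -> : 'X^4 * (Xd * P ^+ 2) = Yd * (('X + 1) ^+ 2 * P) ^+ 2 :> A by rewrite /Xd /Yd; ring.
rewrite Tau_Y Tau_sqr (mulrA 'X^2); congr (_ * Tau (_ * _) ^+ 2).
by rewrite (sqrD2 char2_poly) expr1n mulrDr mulr1 -exprD addrC.
Qed.

(** As d^3 (d + 1) x = d^4 (d + 1)^6 is a square, [opS] exchanges odd and even polynomials
    ([opS_sqr] is the way back); hence only its square is compared with [opT]. *)
Lemma opS_mulXsqr H : opS ('X * H ^+ 2) = opR H ^+ 2.
Proof.
rewrite /opS /opR /trop rmorphM rmorphXn /= comp_polyX.
have -> : 'X^3 * ('X + 1) * (Xd * (H \Po Xd) ^+ 2) =
    ('X^2 * ('X + 1) ^+ 3 * (H \Po Xd)) ^+ 2 :> A by rewrite /Xd; ring.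
by rewrite Tau_sqr; congr (Tau _ ^+ 2); ring.
Qed.

Lemma opS_sqr G : opS (G ^+ 2) = 'X * opQ G ^+ 2.
Proof.
rewrite /opS /opQ /trop rmorphXn /=; move: (G \Po Xd) => P.
have -> : 'X^3 * ('X + 1) * P ^+ 2 = 'X * ('X * P) ^+ 2 + ('X^2 * P) ^+ 2 :> A by ring.
have e3 : 'X^3 * ('X * P) = 'X^2 * ('X^2 * P) :> A by ring.
rewrite linearD /= Tau_oddsqr Tau_sqr e3.
by rewrite -addrA (addrr_pchar2 char2_poly) addr0.
Qed.

Lemma opQ_wle H m : wle H m -> wle (opQ H) (m - 3).
Proof.
apply: trop_wle => k; have := @gen_wle 3 k isT.
by rewrite /gen /= big_cons big_nil mul0r !addr0.
Qed.

(** The sum is the trace against d + d^2 + d^4, that is generators 1 and 2, both of degree -4: one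
    unit better than the -3 available for [opQ] and [opS2] separately. *)
Lemma opQS2_wle H m : wle H m -> wle (opQ H + opS2 H) (m - 4).
Proof.
have -> : opQ H + opS2 H = trop ('X + 'X^2 + 'X^4) H.
  by rewrite /opQ /opS2 /trop -linearD /= -mulrDl addrA.
apply: trop_wle => k; rewrite !mulrDl !linearD /=.
have h1 := @gen_wle 1 k isT; have h2 := @gen_wle 2 k isT.
have := wleD h1 h2.
by rewrite /gen /= !big_cons !big_nil !mul0r !addr0.
Qed.

Lemma opS2_wle H m : wle H m -> wle (opS2 H) (m - 3).
Proof.
move=> h; have -> : opS2 H = opQ H + (opQ H + opS2 H).
  by rewrite addrA (addrr_pchar2 char2_poly) add0r.
apply: wleD; first exact: opQ_wle.
by apply: (wle_trans (opQS2_wle h)); lia.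
Qed.

(** By d^4 (d + 1)^3 = d^4 + d^5 + y d, the difference from the identity is made of generators 2, 5
    and 8, of degrees -4, -2 and -1. *)
Lemma opR_wle H m : wle H m -> wle (opR H + H) (m - 1).
Proof.
move=> hH; rewrite [in opR H + H](poly_sumE H) /opR linear_sum /= -big_split /=.
apply: wle_sum => k; rewrite mem_filter => /andP[/hH hk _].
rewrite trop_Xn.
have -> : Tau ('X^4 * ('X + 1) ^+ 3 * Xd ^+ k) + 'X^k = gen 2 k + gen 5 k + gen 8 k.
  have -> : 'X^4 * ('X + 1) ^+ 3 * Xd ^+ k =
      'X^4 * Xd ^+ k + 'X^5 * Xd ^+ k + Yd * ('X^1 * Xd ^+ k) :> A.
    move: (Xd ^+ k) => Z.
    apply: (eq_mod2 char2_poly (z := ('X^7 + 2 * 'X^6 + 2 * 'X^5 + 'X^4) * Z)).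
    by rewrite /Yd; ring.
  rewrite !linearD /= Tau_Y /gen /= !big_cons !big_nil mul0r mul1r !addr0 -!/(tpow _ _).
  by rewrite -!addrA; congr (_ + (_ + _)); rewrite addrC.
have h2 := @gen_wle 2 k isT; have h5 := @gen_wle 5 k isT.
have h8 := @gen_wle 8 k isT.
by apply: wleD; [apply: wleD|]; [apply: (wle_trans h2)|apply: (wle_trans h5)|
  apply: (wle_trans h8)]; rewrite /gdeg /=; lia.
Qed.

Lemma iter_opQR_wle n H m : wle H m ->
  wle (iter n opS2 H) (m - (3 * n)%:Z) /\
  wle (iter n (opQ \o opR) H + iter n opS2 H) (m - (3 * n)%:Z - 1).
Proof.
move=> hH; elim: n => [|n [IH1 IH2]] /=.
  by rewrite (addrr_pchar2 char2_poly) muln0 subr0; split; [|exact: wle0].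
set a := iter n opS2 H in IH1 IH2 *; set b := iter n (opQ \o opR) H in IH2 *.
split; first by apply: (wle_trans (opS2_wle IH1)); lia.
(* Each of the three summands gains the extra unit, from [opR_wle], the induction hypothesis and
   [opQS2_wle] respectively. *)
have -> : opQ (opR b) + opS2 a = opQ (opR b + b) + opQ (b + a) + (opQ a + opS2 a).
  rewrite /opQ /= !linearD /=.
  by apply: (eq_mod2 char2_poly (z := trop 'X (opR b) + opS2 a + trop 'X b + trop 'X a)); ring.
have hb : wle b (m - (3 * n)%:Z).
  rewrite (_ : b = (b + a) + a); last by rewrite -addrA (addrr_pchar2 char2_poly) addr0.
  by apply: wleD => //; apply: (wle_trans IH2); lia.
apply: wleD; last by apply: (wle_trans (opQS2_wle IH1)); lia.
apply: wleD; first by apply: (wle_trans (opQ_wle (opR_wle hb))); lia.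
by apply: (wle_trans (opQ_wle IH2)); lia.
Qed.

(** This is (4^(s+1) - 1) / 3: the index lags by one behind the s of the theorem. *)
Fixpoint kexp (s : nat) : nat := if s is s'.+1 then (4 * kexp s' + 1)%N else 1%N.

(** All s + 1 base 4 digits are 2, and [w4 2] is 3. *)
Lemma wt_kexp s : wt (2 * kexp s) = (3 * (2 ^ s.+1 - 1))%N.
Proof.
elim: s => // s IH /=; have -> : (2 * (4 * kexp s + 1) = 4 * (2 * kexp s) + 2)%N by lia.
by rewrite wtE // IH /w4 /= !expnS; have := expn_gt0 2 s; lia.
Qed.

Lemma iter_opT_sqr n H : iter n opT ('X * H ^+ 2) = 'X * iter n opS2 H ^+ 2.
Proof. by elim: n => //= n ->; rewrite opT_mulXsqr. Qed.

Lemma iter_opT_pow4 n F : iter n opT ('X * F ^+ 4) = 'X * iter n opS F ^+ 4.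
Proof. by elim: n => //= n ->; rewrite opT_mulXpow4. Qed.

Lemma iter_opS_sqr n H : iter (2 * n) opS ('X * H ^+ 2) = 'X * iter n (opQ \o opR) H ^+ 2.
Proof.
elim: n => // n IH; have -> : (2 * n.+1 = (2 * n).+2)%N by lia.
by rewrite 2!iterS IH opS_mulXsqr opS_sqr.
Qed.

Lemma opT_X5 : opT 'X^5 = 'X.
Proof.
have -> : 'X^5 = 'X * ('X * 1 ^+ 2) ^+ 4 :> A by ring.
rewrite opT_mulXpow4 opS_mulXsqr /opR /trop rmorph1 mulr1.
have -> : 'X^4 * ('X + 1) ^+ 3 = 'X^4 + 'X^5 + 'X^6 + 'X^7 :> A.
  by apply: (eq_mod2 char2_poly (z := 'X^4 + 2 * 'X^5 + 2 * 'X^6 + 'X^7)); ring.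
by rewrite !linearD /= !Tau_Xn !tau_small add0r (addrr_pchar2 char2_poly) add0r !expr1n mulr1.
Qed.

Lemma kexp_sqr s :
  exists2 H : A, 'X^(kexp s) = 'X * H ^+ 2 & wle H (3 * (2 ^ s - 1)%N)%:Z.
Proof.
case: s => [|s].
  by exists 1; [rewrite expr1n mulr1 | exact: (wle_Xn 0)].
exists 'X^(2 * kexp s); last by rewrite -wt_kexp; exact: wle_Xn.
by rewrite -exprM -exprS /=; congr ('X^_); lia.
Qed.

(* With h = 2^s - 1 the weight 3h of H in [kexp_sqr] is used up exactly by h
   applications of [opS2], so the lower terms of (opQ \o opR)^h vanish. *)
Theorem iter_opT_kexp s : iter (2 ^ s - 1) opT 'X^(kexp s) = 'X.
Proof.
elim: s => [|s IH]; first by rewrite /= expr1.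
(* The even number of steps leads to ['X^5]; the remaining one is [opT_X5]. *)
have -> : (2 ^ s.+1 - 1 = (2 * (2 ^ s - 1)).+1)%N.
  by rewrite expnS; have := expn_gt0 2 s; lia.
have [H eH wH] := kexp_sqr s.
have -> : 'X^(kexp s.+1) = 'X * 'X^(kexp s) ^+ 4 :> A.
  by rewrite -exprM -exprS /=; congr ('X^_); lia.
move: IH wH; rewrite eH; set h := (2 ^ s - 1)%N => IH wH.
rewrite iterS iter_opT_pow4 iter_opS_sqr.
have e1 : iter h opS2 H = 1.
  have X0 : 'X != 0 :> A by rewrite polyX_eq0.
  apply/(eq_mod2 char2_poly (z := 0))/eqP.
  move: IH; rewrite iter_opT_sqr -[RHS]mulr1 => /(mulfI X0) e.
  by rewrite addr0 -sqrf_eq0 (sqrD2 char2_poly) e expr1n (addrr_pchar2 char2_poly).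
have [_ w] := iter_opQR_wle h wH.
have -> : iter h (opQ \o opR) H = 1.
  have w0 : (3 * h)%N%:Z - (3 * h)%N%:Z - 1 < 0 by lia.
  by move: (wle_neg w0 w); rewrite e1 => e; apply: (eq_mod2 char2_poly (z := 0)); rewrite e addr0.
by rewrite expr1n mulr1 -exprS opT_X5.
Qed.

(** * Power series over F_2 *)

Record series := Series { scoef :> nat -> 'F_2 }.

Lemma seriesP (a b : series) : (forall n, a n = b n) -> a = b.
Proof. by case: a => a; case: b => b /= e; congr Series; apply: funext. Qed.

HB.instance Definition _ := gen_eqMixin series.
HB.instance Definition _ := gen_choiceMixin series.

Definition ser0 := Series (fun=> 0).
Definition ser1 := Series (fun n => (n == 0)%:R).
Definition sadd (a b : series) := Series (fun n => a n + b n).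
Definition sopp (a : series) := Series (fun n => - a n).
Definition smul (a b : series) := Series (fun n => \sum_(i < n.+1) a i * b (n - i)%N).

(* Transports the ring axioms from polynomials. *)
Definition trunc (N : nat) (a : series) : A := \poly_(i < N) a i.

Lemma smul_trunc N a b n : (n < N)%N -> smul a b n = (trunc N a * trunc N b)`_n.
Proof.
move=> ltnN; rewrite coefM /=; apply: eq_bigr => i _; have := ltn_ord i.
by rewrite !coef_poly => h; rewrite !ifT //; lia.
Qed.

Lemma trunc_smul N a b n : (n < N)%N -> (trunc N (smul a b))`_n = (trunc N a * trunc N b)`_n.
Proof. by move=> h; rewrite coef_poly h (smul_trunc _ _ h). Qed.

Fact saddA : associative sadd.
Proof. by move=> a b c; apply: seriesP => n; rewrite /= addrA. Qed.
Fact saddC : commutative sadd.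
Proof. by move=> a b; apply: seriesP => n; rewrite /= addrC. Qed.
Fact sadd0 : left_id ser0 sadd.
Proof. by move=> a; apply: seriesP => n; rewrite /= add0r. Qed.
Fact saddN : left_inverse ser0 sopp sadd.
Proof. by move=> a; apply: seriesP => n; rewrite /= addNr. Qed.
HB.instance Definition _ := GRing.isZmodule.Build series saddA saddC sadd0 saddN.

Fact smulC : commutative smul.
Proof.
by move=> a b; apply: seriesP => n; rewrite !(smul_trunc _ _ (ltnSn n)) mulrC.
Qed.

Lemma coefM_eq (p p' q q' : A) n :
  (forall i, (i <= n)%N -> p`_i = p'`_i) -> (forall i, (i <= n)%N -> q`_i = q'`_i) ->
  (p * q)`_n = (p' * q')`_n.
Proof.
move=> hp hq; rewrite !coefM; apply: eq_bigr => i _; have := ltn_ord i => h.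
by rewrite hp ?hq //; lia.
Qed.

Fact smulA : associative smul.
Proof.
move=> a b c; apply: seriesP => n; rewrite !(smul_trunc _ _ (ltnSn n)).
transitivity ((trunc n.+1 a * (trunc n.+1 b * trunc n.+1 c))`_n).
  by apply: coefM_eq => // i le; rewrite trunc_smul.
by rewrite mulrA; apply: coefM_eq => // i le; rewrite trunc_smul.
Qed.
Fact smul1 : left_id ser1 smul.
Proof.
move=> a; apply: seriesP => n; rewrite /= big_ord_recl /= mul1r subn0 big1 ?addr0 // => i _.
by rewrite mul0r.
Qed.
Fact smulDl : left_distributive smul sadd.
Proof.
move=> a b c; apply: seriesP => n; rewrite /= -big_split /=.
by apply: eq_bigr => i _; rewrite mulrDl.
Qed.
Fact s1_neq0 : ser1 != 0.
Proof. by apply/eqP => /(congr1 (fun a : series => a 0%N)). Qed.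
HB.instance Definition _ :=
  GRing.Zmodule_isComNzRing.Build series smulA smulC smul1 smulDl s1_neq0.

Lemma serD (a b : series) n : (a + b) n = a n + b n. Proof. by []. Qed.
Lemma ser0E n : (0 : series) n = 0. Proof. by []. Qed.
Lemma ser1E n : (1 : series) n = (n == 0)%:R. Proof. by []. Qed.
Lemma serM (a b : series) n : (a * b) n = \sum_(i < n.+1) a i * b (n - i)%N.
Proof. by []. Qed.
Lemma serMnat (a b : series) n : (a * b) n = \sum_(0 <= i < n.+1) a i * b (n - i)%N.
Proof. by rewrite serM big_mkord. Qed.

Lemma char2_series : 2%N \in [pchar series].
Proof.
rewrite inE /=; apply/eqP; apply: seriesP => n.
by rewrite serD (addrr_pchar2 char2_F2).
Qed.

(** * Dilation q -> q^p, section at multiples of 5, and theta *)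

Definition dil (p : nat) (a : series) := Series (fun n => if (p %| n)%N then a (n %/ p)%N else 0).
Definition sec5 (a : series) := Series (fun n => a (5 * n)%N).

Lemma dilE p (a : series) n : dil p a n = if (p %| n)%N then a (n %/ p)%N else 0.
Proof. by []. Qed.

Lemma dil_muln p (a : series) n : (0 < p)%N -> dil p a (p * n)%N = a n.
Proof. by move=> p0; rewrite dilE dvdn_mulr // mulKn. Qed.

Lemma sum_dvd (R : nmodType) p n (F : nat -> R) : (0 < p)%N ->
  \sum_(0 <= i < (p * n).+1 | (p %| i)%N) F i = \sum_(0 <= j < n.+1) F (p * j)%N.
Proof.
move=> p0; elim: n => [|n IH].
  by rewrite muln0 big_mkcond !big_nat1 dvdn0 muln0.
rewrite [RHS]big_nat_recr //= -IH mulnS.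
rewrite (big_cat_nat (n := (p * n).+1)) //=; last by lia.
congr (_ + _); rewrite big_mkcond big_nat_recr /=; last by lia.
rewrite -mulnS dvdn_mulr // big_nat big1 ?add0r // => i /andP[h1 h2].
case: ifP => // /dvdnP[m em].
have : (n < m)%N by rewrite -(ltn_pmul2l p0); lia.
have : (m < n.+1)%N by rewrite -(ltn_pmul2l p0) mulnS; lia.
by lia.
Qed.

Lemma dil1 p : (0 < p)%N -> dil p 1 = 1.
Proof.
move=> p0; apply: seriesP => n; rewrite dilE !ser1E; case: ifP => [/dvdnP[m ->]|].
  by rewrite mulnK // muln_eq0 (gtn_eqF p0) orbF.
by case: n => //; rewrite dvdn0.
Qed.

Lemma dilD p (a b : series) : dil p (a + b) = dil p a + dil p b.
Proof. by apply: seriesP => n; rewrite serD !dilE; case: ifP => // _; rewrite addr0. Qed.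

Lemma dilM p (a b : series) : (0 < p)%N -> dil p (a * b) = dil p a * dil p b.
Proof.
move=> p0; apply: seriesP => n; rewrite dilE.
case: ifP => [/dvdnP[m ->]|ndiv].
  rewrite mulnK // !serMnat [(m * p)%N]mulnC.
  transitivity (\sum_(0 <= i < (p * m).+1 | (p %| i)%N) dil p a i * dil p b (p * m - i)%N).
    rewrite sum_dvd //; apply: eq_bigr => i _.
    by rewrite -mulnBr !dil_muln.
  by rewrite big_mkcond; apply: eq_bigr => i _; case: ifP => // h; rewrite dilE h mul0r.
rewrite serMnat big_nat big1 // => i /andP[_ hi]; rewrite !dilE.
case: ifP => [di|]; last by rewrite mul0r.
case: ifP => [dj|]; last by rewrite mulr0.
by move: ndiv; rewrite -(subnKC (m := i) (n := n)) ?dvdn_add //; lia.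
Qed.

Lemma dilX p (a : series) k : (0 < p)%N -> dil p (a ^+ k) = dil p a ^+ k.
Proof. by move=> p0; elim: k => [|k IH]; rewrite ?dil1 // !exprS dilM // IH. Qed.

Lemma dil_dil p r (a : series) : (0 < p)%N -> (0 < r)%N -> dil p (dil r a) = dil (p * r) a.
Proof.
move=> p0 r0; apply: seriesP => n; rewrite !dilE.
case: (boolP (p * r %| n)%N) => [/dvdnP[m ->]|h].
  have -> : (m * (p * r) = p * (r * m))%N by lia.
  by rewrite dvdn_mulr // mulKn // dvdn_mulr // mulKn // mulnA mulKn ?muln_gt0 ?p0.
case: ifP => // /dvdnP[m e]; move: h; rewrite e mulnK //; case: ifP => // d.
by rewrite mulnC dvdn_pmul2r // d.
Qed.

Lemma dil_inj p : (0 < p)%N -> injective (dil p).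
Proof.
move=> p0 a b e; apply: seriesP => n.
by rewrite -(dil_muln a n p0) e dil_muln.
Qed.

Lemma sec5D (a b : series) : sec5 (a + b) = sec5 a + sec5 b.
Proof. by []. Qed.

Lemma sec5K (a : series) : sec5 (dil 5 a) = a.
Proof. by apply: seriesP => n; rewrite /= dvdn_mulr // mulKn. Qed.

Lemma sec5M (a b : series) :
  (forall i j, a i != 0 -> b j != 0 -> (5 %| i + j)%N -> (5 %| i)%N) ->
  sec5 (a * b) = sec5 a * sec5 b.
Proof.
move=> h; apply: seriesP => n; rewrite [LHS]serMnat serMnat.
transitivity (\sum_(0 <= i < (5 * n).+1 | (5 %| i)%N) a i * b (5 * n - i)%N).
  rewrite [RHS]big_mkcond; apply: eq_big_nat => i /andP[_ hi].
  case: ifP => // /negP ndiv.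
  have [->|ai] := eqVneq (a i) 0; first by rewrite mul0r.
  have [->|bj] := eqVneq (b (5 * n - i)%N) 0; first by rewrite mulr0.
  by case: ndiv; apply: (h _ _ ai bj); rewrite subnKC ?dvdn_mulr //; lia.
by rewrite sum_dvd //; apply: eq_bigr => i _; rewrite -mulnBr.
Qed.

Lemma sec5_dilM (a b : series) : sec5 (dil 5 a * b) = a * sec5 b.
Proof.
by rewrite sec5M ?sec5K // => i j; rewrite dilE; case: ifP => //; rewrite eqxx.
Qed.

Lemma sum_invol (R : comNzRingType) (ch : 2%N \in [pchar R]) (I : eqType) (s : seq I)
    (sg : I -> I) (F : I -> R) :
  uniq s -> {in s, forall x, sg x \in s} -> {in s, forall x, sg (sg x) = x} ->
  {in s, forall x, F (sg x) = F x} ->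
  \sum_(x <- s) F x = \sum_(x <- s | sg x == x) F x.
Proof.
have [n] := ubnP (size s); elim: n s => // n IH [|x s] /=; first by rewrite !big_nil.
move=> /ltnSE le /andP[xs us] h1 h2 h3.
rewrite !big_cons; case: eqVneq => [e|ne].
  congr (_ + _); apply: IH => // y ys.
  - have := h1 y; rewrite !inE ys orbT => /(_ isT) /orP[/eqP e'|//].
    by move: xs; rewrite -e -e' h2 ?inE ?ys ?orbT.
  - by apply: h2; rewrite inE ys orbT.
  - by apply: h3; rewrite inE ys orbT.
have xin : x \in x :: s by rewrite mem_head.
have sx : sg x \in s by have := h1 x xin; rewrite inE (negbTE ne).
rewrite !(perm_big _ (perm_to_rem sx)) /= !big_cons h3 // h2 //.
rewrite addrA (addrr_pchar2 ch) add0r (eq_sym x) (negbTE ne).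
have remP y : y \in rem (sg x) s = (y != sg x) && (y \in s) by exact: mem_rem_uniq.
apply: IH => [||y|y|y].
- by rewrite size_rem //; lia.
- exact: rem_uniq.
- rewrite !remP => /andP[yx ys]; have yi : y \in x :: s by rewrite inE ys orbT.
  have := h1 y yi; rewrite inE => /orP[/eqP e|->].
    by move: yx; rewrite -e h2 ?eqxx.
  rewrite andbT; apply/eqP => /(congr1 sg); rewrite !h2 // => e.
  by move: xs; rewrite -e ys.
- by rewrite remP => /andP[_ ys]; apply: h2; rewrite inE ys orbT.
- by rewrite remP => /andP[_ ys]; apply: h3; rewrite inE ys orbT.
Qed.

Lemma sqr_dil (a : series) : a ^+ 2 = dil 2 a.
Proof.
apply: seriesP => n; rewrite expr2 serMnat -[index_iota 0 n.+1]/(iota 0 n.+1).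
have sP i : (i \in iota 0 n.+1) = (i <= n)%N by rewrite mem_iota.
have us := iota_uniq 0 n.+1; move: (iota 0 n.+1) us sP => s us sP.
rewrite (sum_invol char2_F2 (sg := fun i => (n - i)%N)) //; first last.
- by move=> i; rewrite sP => h; rewrite mulrC subKn.
- by move=> i; rewrite sP; lia.
- by move=> i; rewrite !sP; lia.
rewrite dilE; case: ifP => [/dvdnP[m e]|odd_n].
  have ms : m \in s by rewrite sP; lia.
  rewrite big_mkcond (bigD1_seq m ms) //= big_seq_cond big1 ?addr0.
    have -> : (n - m = m)%N by lia.
    by rewrite eqxx e mulnK //; case: (F2P (a m)) => ->; rewrite ?mulr0 ?mulr1.
  move=> i /andP[]; rewrite sP => hi ne; rewrite ifF //.
  by apply/negbTE/eqP => ei; move/eqP: ne; apply; lia.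
rewrite big_seq_cond big1 // => i /andP[]; rewrite sP => hi /eqP e.
by move: odd_n; rewrite (_ : n = i * 2)%N ?dvdn_mull //; lia.
Qed.

Lemma sec5_sqr (a : series) : sec5 (a ^+ 2) = sec5 a ^+ 2.
Proof.
rewrite !sqr_dil; apply: seriesP => n; rewrite dilE /= Gauss_dvdr //.
by case: ifP => // h; rewrite muln_divA.
Qed.

Lemma series_mulf_eq0 (a b : series) : a * b = 0 -> a = 0 \/ b = 0.
Proof.
move=> ab0; have [|na] := EM (forall n, a n = 0); first by move=> h; left; exact: seriesP.
right; apply: seriesP => n.
have [i ai0] : exists i, a i != 0.
  by apply: contrapT => h; apply: na => n'; apply/eqP/negPn/negP => h'; apply: h; exists n'.
have [{ai0} {}i ai0 imin] := ex_minnP (ex_intro (fun i => a i != 0) i ai0).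
elim/ltn_ind: n => n IH; apply/eqP/negPn/negP => bn.
have /eqP : (a * b) (i + n)%N = 0 by rewrite ab0.
have iin : (i < (i + n).+1)%N by lia.
rewrite serM (bigD1 (Ordinal iin)) //= big1 ?addr0.
  by rewrite addKn mulf_eq0 (negbTE ai0) (negbTE bn).
move=> [j hj] /= ne; have {}ne : j != i by apply: contra ne => /eqP e; apply/eqP/val_inj.
case: (ltngtP j i) ne => // lt _; last by rewrite IH ?mulr0 //; lia.
have -> : a j = 0 by apply/eqP/negPn/negP => /imin; lia.
by rewrite mul0r.
Qed.

Definition sqind (C : pred nat) : series :=
  Series (fun n => [exists x : 'I_n.+1, C x && (n == x ^ 2)%N]%:R).

Lemma sqind_neq0 (C : pred nat) n : sqind C n != 0 <-> exists2 x, C x & n = (x ^ 2)%N.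
Proof.
rewrite /=; case: existsP => h; split.
- by move=> _; case: h => x /andP[Cx /eqP e]; exists x.
- by [].
- by rewrite eqxx.
- case=> x Cx e; case: h.
  have xn : (x < n.+1)%N by rewrite e; case: x {Cx e} => // x; nia.
  by exists (Ordinal xn); rewrite Cx; apply/eqP.
Qed.

Lemma sqind_eq1 (C : pred nat) n : sqind C n = 1 <-> exists2 x, C x & n = (x ^ 2)%N.
Proof.
by rewrite -sqind_neq0; case: (F2P (sqind C n)) => ->; split.
Qed.

Definition theta := sqind odd.
Definition theta5 := dil 5 theta.

Lemma sec5_1 : sec5 1 = 1.
Proof. by rewrite -[in LHS](dil1 (p := 5)) // sec5K. Qed.

Lemma dvd_sqr p x : prime p -> (p %| x ^ 2)%N = (p %| x)%N.
Proof. by move=> pp; rewrite Euclid_dvdX // andbT. Qed.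

Lemma sec5_theta : sec5 theta = theta5.
Proof.
apply: seriesP => n; rewrite /theta5 dilE.
have -> : sec5 theta n = theta (5 * n)%N by [].
case: ifP => [/dvdnP[m ->]|ndiv].
  rewrite mulnK //.
  have h : theta (5 * (m * 5))%N = 1 <-> theta m = 1.
    rewrite !sqind_eq1; split => -[x ox e].
      have /dvdnP[y ey] : (5 %| x)%N by rewrite -(@dvd_sqr 5) // -e dvdn_mulr.
      exists y; last by move: e; rewrite ey expnMn; lia.
      by move: ox; rewrite ey oddM => /andP[].
    by exists (5 * x)%N; [rewrite oddM|rewrite e expnMn; lia].
  case: (F2P (theta m)) h => -> h; last by apply/h.
  by case: (F2P (theta (5 * (m * 5))%N)) h => -> // [/(_ erefl)].
case: (F2P (theta (5 * n)%N)) => // /sqind_eq1[x _ e].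
have /dvdnP[y ey] : (5 %| x)%N by rewrite -(@dvd_sqr 5) // -e dvdn_mulr.
by move: ndiv; rewrite (_ : n = 5 * y ^ 2)%N ?dvdn_mulr //; move: e; rewrite ey expnMn; lia.
Qed.

(* -2 is not a square modulo 5. *)
Lemma sec5_theta3 : sec5 (theta ^+ 3) = theta5 ^+ 3.
Proof.
rewrite exprS sec5M ?sec5_sqr ?sec5_theta -?exprS //.
move=> i j /sqind_neq0[x _ ->]; rewrite sqr_dil dilE.
case: ifP => [/dvdnP[m ->]|]; last by rewrite eqxx.
rewrite mulnK // => /sqind_neq0[y _ ->] h.
rewrite (@dvd_sqr 5) //; move: h; rewrite /dvdn.
rewrite -modnDm -modnMml -modnXm -(modnXm 2 5 y).
have := ltn_pmod x (isT : 0 < 5)%N; have := ltn_pmod y (isT : 0 < 5)%N.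
by case: (x %% 5)%N => [|[|[|[|[|?]]]]] //; case: (y %% 5)%N => [|[|[|[|[|?]]]]].
Qed.

Lemma theta0 : theta 0%N = 0.
Proof. by case: (F2P (theta 0%N)) => // /sqind_eq1[[|x] //]. Qed.

Lemma theta1 : theta 1%N = 1.
Proof. by apply/sqind_eq1; exists 1%N. Qed.

(** * Binary quadratic forms modulo 2 *)

Arguments dil : simpl never.
Arguments sqind : simpl never.

Definition eta := sqind (fun x => coprime x 6).

Lemma coprime6P x : coprime x 6 = odd x && ~~ (3 %| x)%N.
Proof.
rewrite (_ : 6%N = (2 * 3)%N) // coprimeMr [coprime x 2]coprime_sym coprime2n.
by rewrite [coprime x 3]coprime_sym prime_coprime.
Qed.

(* Every positive integer prime to 6 is the absolute value of exactly one
   integer congruent to 5 modulo 6. *)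
Lemma etaP n : eta n = 1 <-> exists2 x : int, (x %% 6)%Z = 5 & x ^+ 2 = n%:Z.
Proof.
rewrite sqind_eq1; split=> -[x].
  rewrite coprime6P => /andP[ox n3] ->.
  have [h|h] : (x %% 6 = 5)%N \/ (x %% 6 = 1)%N by lia.
    by exists x%:Z; [lia | rewrite expr2; lia].
  by exists (- x%:Z); [lia | rewrite expr2; lia].
move=> x5 e; exists `|x|%N; first by rewrite coprime6P; lia.
by apply/eqP; rewrite -eqz_nat -e -abszX; apply/eqP; rewrite expr2; nia.
Qed.

Lemma sum_F2 (I : Type) (r : seq I) (P : pred I) :
  \sum_(i <- r | P i) 1 = (size [seq i <- r | P i])%:R :> 'F_2.
Proof. by rewrite -big_filter big_const_seq count_predT iter_addr_0. Qed.

Lemma F2_mulE (x y : 'F_2) : x * y = if (x == 1) && (y == 1) then 1 else 0.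
Proof. by case: (F2P x) (F2P y) => -> [] ->; rewrite ?mul0r ?mulr0 ?mulr1. Qed.

Lemma conv_eta (a n : nat) (s : seq (int * int)) : (0 < a)%N -> uniq s ->
  (forall x y, ((x, y) \in s) =
     [&& (x %% 6)%Z == 5, (y %% 6)%Z == 5 & x ^+ 2 + a%:Z * y ^+ 2 == n%:Z]) ->
  (eta * dil a eta) n = (size s)%:R.
Proof.
move=> a0 us sP; rewrite serMnat.
transitivity (\sum_(0 <= i < n.+1 | (eta i == 1) && (dil a eta (n - i)%N == 1)) (1 : 'F_2)).
  rewrite [RHS]big_mkcond; apply: eq_bigr => i _.
  exact: F2_mulE.
rewrite sum_F2 -(size_map (fun p => `|p.1 ^+ 2|%N) s); congr (_%:R); apply: (@perm_size nat).
have sqi (x y : int) : (x %% 6)%Z = 5 -> (y %% 6)%Z = 5 -> x ^+ 2 = y ^+ 2 -> x = y.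
  by move=> hx hy /eqP; rewrite eqf_sqr => /orP[/eqP //|/eqP e]; lia.
apply: uniq_perm; first by rewrite filter_uniq // iota_uniq.
  rewrite map_inj_in_uniq // => -[x y] [x' y'] /= h h' e.
  move: h h'; rewrite !sP => /and3P[/eqP x5 /eqP y5 /eqP e1] /and3P[/eqP x5' /eqP y5' /eqP e1'].
  have ex : x ^+ 2 = x' ^+ 2.
    by move: e => /(congr1 Posz); rewrite !gez0_abs ?sqr_ge0.
  have ey : y ^+ 2 = y' ^+ 2.
    have a0' : a%:Z != 0 by lia.
    by apply: (mulfI a0'); move: e1'; rewrite -e1 ex => /addrI ->.
  by rewrite (sqi x x') // (sqi y y').
move=> i; rewrite mem_filter mem_index_iota; apply/idP/mapP.
  move=> /andP[/andP[/eqP/etaP[x x5 ex]]]; rewrite dilE.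
  case: ifP => // /dvdnP[m em]; rewrite em mulnK // => /eqP/etaP[y y5 ey] ilen.
  exists (x, y); last by rewrite /= ex.
  by rewrite sP x5 y5 !eqxx /= ex ey; apply/eqP; lia.
move=> [[x y]]; rewrite sP => /and3P[/eqP x5 /eqP y5 /eqP e] ei.
have {ei i} -> : i = `|x ^+ 2|%N by exact: ei.
have ex : `|x ^+ 2|%N%:Z = x ^+ 2 by rewrite gez0_abs ?sqr_ge0.
have ey : `|y ^+ 2|%N%:Z = y ^+ 2 by rewrite gez0_abs ?sqr_ge0.
have en : (n = `|x ^+ 2| + `|y ^+ 2| * a)%N by lia.
rewrite -andbA; apply/and3P; split; last by lia.
  by apply/eqP/etaP; exists x; rewrite // ex.
rewrite dilE {1 2}en addKn dvdn_mull // mulnK //.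
by apply/eqP/etaP; exists y; rewrite // ey.
Qed.

Definition box (B : nat) : seq (int * int) :=
  [seq (i%:Z - B%:Z, j%:Z - B%:Z) | i <- iota 0 (2 * B).+1, j <- iota 0 (2 * B).+1].

Lemma box_uniq B : uniq (box B).
Proof.
apply: allpairs_uniq; rewrite ?iota_uniq // => -[i j] [i' j'] _ _ [].
by move=> *; congr (_, _); lia.
Qed.

Lemma mem_box B x y : (`|x| <= B)%N -> (`|y| <= B)%N -> (x, y) \in box B.
Proof.
move=> hx hy; apply/allpairsP; exists (absz (x + B%:Z), absz (y + B%:Z)).
rewrite !mem_iota /=; split; try lia.
by congr (_, _); lia.
Qed.

Definition qsols (a : nat) (C : int -> int -> bool) (M : nat) : seq (int * int) :=
  [seq p <- box M | C p.1 p.2 && (p.1 ^+ 2 + a%:Z * p.2 ^+ 2 == M%:Z)].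

Lemma qsols_uniq a C M : uniq (qsols a C M).
Proof. by rewrite filter_uniq // box_uniq. Qed.

Lemma mem_qsols a C M x y : (0 < a)%N ->
  ((x, y) \in qsols a C M) = C x y && (x ^+ 2 + a%:Z * y ^+ 2 == M%:Z).
Proof.
move=> a0; rewrite mem_filter /=; apply: andb_idr => /andP[_ /eqP e].
by apply: mem_box; nia.
Qed.

Definition qcount a C : series := Series (fun M => (size (qsols a C M))%:R).

(** What x = y = 5 modulo 6 becomes for x = u - a v and y = u + v: if a = 5 the two congruences
    coincide, if a = 2 their difference 3 v forces v to be even. *)
Definition C5 (u v : int) : bool := ((u + v) %% 6)%Z == 5.
Definition C2 (u v : int) : bool := C5 u v && ((v %% 2)%Z == 0).

(* The substitution (x, y) = (u - a v, u + v) multiplies x^2 + a y^2 by a + 1. *)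
Lemma conv_qcount a C : (0 < a)%N -> ((a == 2) || (a == 5))%N ->
  (forall u v : int, C u v = (((u - a%:Z * v) %% 6)%Z == 5) && (((u + v) %% 6)%Z == 5)) ->
  eta * dil a eta = dil a.+1 (qcount a C).
Proof.
move=> a0 a25 CE; apply: seriesP => n; rewrite dilE.
case: ifP => [/dvdnP[M en]|ndiv].
  rewrite en mulnK // -en.
  pose h (p : int * int) := (p.1 - a%:Z * p.2, p.1 + p.2).
  rewrite (@conv_eta a n [seq h p | p <- qsols a C M]) ?size_map //.
    rewrite map_inj_uniq ?qsols_uniq // => -[u v] [u' v'] [e1 e2].
    have e : (1 + a%:Z) * v = (1 + a%:Z) * v' by lia.
    have a1 : 1 + a%:Z != 0 by lia.
    by move/(mulfI a1): e e2 => -> /addIr ->.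
  move=> x y; apply/mapP/and3P.
    move=> [[u v]]; rewrite mem_qsols // CE => /andP[/andP[h1 h2] /eqP e] [-> ->].
    split=> //; apply/eqP; have -> : n%:Z = (1 + a%:Z) * M%:Z by lia.
    by rewrite -e; ring.
  case=> /eqP x5 /eqP y5 /eqP e.
  (* a + 1 is 3 or 6, while x and y agree modulo 6. *)
  have [v ev] : exists v, y - x = (1 + a%:Z) * v.
    by case/orP: a25 => /eqP ea; exists ((y - x) %/ (1 + a%:Z))%Z; rewrite ea; lia.
  have exy : x = y - v - a%:Z * v by lia.
  exists (y - v, v); last by rewrite /h /= subrK -exy.
  have y5' : ((y - v + v) %% 6)%Z == 5 by apply/eqP; rewrite -y5; congr (modz _ _); ring.
  rewrite mem_qsols // CE y5' -exy x5 eqxx /=.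
  have a1 : 1 + a%:Z != 0 by lia.
  apply/eqP/(mulfI a1); rewrite (_ : (1 + a%:Z) * M%:Z = n%:Z); last by lia.
  by rewrite -e exy; ring.
rewrite (@conv_eta a n [::]) // => x y; rewrite in_nil; apply/esym/and3P => -[/eqP x5 /eqP y5 /eqP e].
move/negP: ndiv; apply; have [v ev] : exists v, y - x = (1 + a%:Z) * v.
  by case/orP: a25 => /eqP ea; exists ((y - x) %/ (1 + a%:Z))%Z; rewrite ea; lia.
have exy : x = y - v - a%:Z * v by lia.
have : n%:Z = (1 + a%:Z) * ((y - v) ^+ 2 + a%:Z * v ^+ 2) by rewrite -e exy; ring.
move=> en; apply/dvdnP; exists `|((y - v) ^+ 2 + a%:Z * v ^+ 2)%R|%N.
have az : 0 <= a%:Z by [].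
have := addr_ge0 (sqr_ge0 (y - v)) (mulr_ge0 az (sqr_ge0 v)).
by lia.
Qed.

Lemma conv5 : eta * dil 5 eta = dil 6 (qcount 5 C5).
Proof. by apply: conv_qcount => // u v; rewrite /C5; lia. Qed.

Lemma conv2 : eta * dil 2 eta = dil 3 (qcount 2 C2).
Proof. by apply: conv_qcount => // u v; rewrite /C2 /C5; lia. Qed.

Lemma size_le1 (T : eqType) (s : seq T) :
  uniq s -> {in s &, forall x y, x = y} -> size s = (s != [::]).
Proof.
case: s => [|x [|y s]] //= /andP[]; rewrite inE => /norP[/negP xy _] _ h.
by case: xy; apply/eqP/h; rewrite !inE eqxx ?orbT.
Qed.

Lemma eq_F2 (x y : 'F_2) : (x = 1 <-> y = 1) -> x = y.
Proof. by case: (F2P x) (F2P y) => -> [] -> // [h1 h2]; rewrite ?h1 ?h2. Qed.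

Lemma sum1_le1 (T : eqType) (s : seq T) (P : pred T) (c : 'F_2) : uniq s ->
  {in s &, forall x y, P x -> P y -> x = y} ->
  (c = 1 <-> exists2 x, x \in s & P x) -> \sum_(x <- s | P x) 1 = c.
Proof.
move=> us inj cP; apply: eq_F2; rewrite cP sum_F2 size_le1 ?filter_uniq //.
  by rewrite -has_filter; case: hasP => h; split=> // [/eqP|/h //].
by move=> x y; rewrite !mem_filter => /andP[Px xs] /andP[Py ys]; exact: inj.
Qed.

(* Where neither v |-> - v nor u |-> - u preserves the congruence modulo 6, one
   has u = v + 3t; then u^2 + 5v^2 = 3(2v^2 + 2vt + 3t^2) and u^2 + 2v^2 =
   3((v + t)^2 + 2t^2), and the involutions come from automorphs of these forms.
   On the last class the form is divisible by 9, see [qcount_desc]. *)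
Definition sg5 (p : int * int) : int * int :=
  let: (u, v) := p in
  if (v %% 3)%Z == 0 then (u, - v) else
  if (v %% 3)%Z == 2 then (- u, v) else
  let t := ((u - v) %/ 3)%Z in
  if (t %% 3)%Z == 0 then (v - 2 * t, v + t) else
  if (t %% 3)%Z == 1 then (2 * t - v, - v - t) else (u, v).

Definition sg2 (p : int * int) : int * int :=
  let: (u, v) := p in
  if (v %% 3)%Z == 0 then (u, - v) else
  if (v %% 3)%Z == 2 then (- u, v) else
  let t := ((u - v) %/ 3)%Z in
  if (t %% 3)%Z == 0 then (v - t, v + 2 * t) else
  if (t %% 3)%Z == 2 then (t - v, - v - 2 * t) else (u, v).

Definition desc (e : int) (p : int * int) : bool :=
  ((p.2 %% 3)%Z == 1) && ((((p.1 - p.2) %/ 3)%Z %% 3)%Z == e).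

Lemma sg5_sols M : {in qsols 5 C5 M, forall p, sg5 p \in qsols 5 C5 M}.
Proof.
move=> [u v]; rewrite mem_qsols // /C5 => /andP[/eqP h /eqP e]; rewrite /sg5.
case: eqP => h0; first by rewrite mem_qsols // /C5 -e sqrrN eqxx andbT; lia.
case: eqP => h1; first by rewrite mem_qsols // /C5 -e sqrrN eqxx andbT; lia.
set t := ((u - v) %/ 3)%Z; have eu : u = v + 3 * t by rewrite /t; lia.
case: eqP => h2.
  rewrite mem_qsols // /C5 -e; apply/andP; split; first by lia.
  by apply/eqP; rewrite eu; ring.
case: eqP => h3.
  rewrite mem_qsols // /C5 -e; apply/andP; split; first by lia.
  by apply/eqP; rewrite eu; ring.
by rewrite mem_qsols // /C5 h e !eqxx.
Qed.

Lemma sg5_inv M : {in qsols 5 C5 M, forall p, sg5 (sg5 p) = p}.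
Proof.
move=> [u v]; rewrite mem_qsols // /C5 => /andP[/eqP h _]; rewrite /sg5.
case: (eqVneq (v %% 3)%Z 0) => h0; first by rewrite ifT ?opprK //; lia.
case: (eqVneq (v %% 3)%Z 2) => h1; first by rewrite (negbTE h0) h1 ?opprK.
set t := ((u - v) %/ 3)%Z; have eu : u = v + 3 * t by rewrite /t; lia.
case: (eqVneq (t %% 3)%Z 0) => h2.
  have et : ((v - 2 * t - (v + t)) %/ 3 = - t)%Z by lia.
  have e1 : ((v + t) %% 3)%Z = 1 by lia.
  have e2 : ((- t) %% 3)%Z = 0 by lia.
  by rewrite et e1 e2 /=; congr (_, _); lia.
case: (eqVneq (t %% 3)%Z 1) => h3.
  have et : ((2 * t - v - (- v - t)) %/ 3 = t)%Z by lia.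
  have e1 : ((- v - t) %% 3)%Z = 1 by lia.
  by rewrite et e1 h3 /=; congr (_, _); lia.
by rewrite (negbTE h0) (negbTE h1) -/t (negbTE h2) (negbTE h3).
Qed.

Lemma sg5_fix u v : C5 u v ->
  (if sg5 (u, v) == (u, v) then 1 else 0) =
  (if v == 0 then 1 else 0) + (if u == 0 then 1 else 0) + (if desc 2 (u, v) then 1 else 0) :> 'F_2.
Proof.
rewrite /C5 /sg5 /desc /= => /eqP h.
set t := ((u - v) %/ 3)%Z.
have -> : ((if (v %% 3)%Z == 0 then (u, - v)
  else if (v %% 3)%Z == 2 then (- u, v)
  else if (t %% 3)%Z == 0 then (v - 2 * t, v + t)
  else if (t %% 3)%Z == 1 then (2 * t - v, - v - t) else (u, v)) == (u, v)) =
  [|| v == 0, u == 0 | ((v %% 3)%Z == 1) && ((t %% 3)%Z == 2)].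
  do 4?case: ifP => ?; rewrite xpair_eqE; lia.
have : ~~ ((v == 0) && (u == 0)) by lia.
have : ~~ ((v == 0) && (((v %% 3)%Z == 1) && ((t %% 3)%Z == 2))) by lia.
have : ~~ ((u == 0) && (((v %% 3)%Z == 1) && ((t %% 3)%Z == 2))) by lia.
by case: (v == 0); case: (u == 0); case: ((v %% 3)%Z == 1); case: ((t %% 3)%Z == 2) => // _ _ _;
  rewrite ?addr0 ?add0r.
Qed.

Lemma qcount_sg5 M : qcount 5 C5 M =
  \sum_(p <- qsols 5 C5 M | p.2 == 0) 1 + \sum_(p <- qsols 5 C5 M | p.1 == 0) 1 +
  \sum_(p <- qsols 5 C5 M | desc 2 p) 1.
Proof.
rewrite -[LHS]/((size (qsols 5 C5 M))%:R) -[size _](count_predT) -size_filter -sum_F2.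
rewrite (sum_invol char2_F2 (sg := sg5)) ?qsols_uniq //.
- rewrite big_mkcond [X in _ = X + _ + _]big_mkcond [X in _ = _ + X + _]big_mkcond.
  rewrite [X in _ = _ + _ + X]big_mkcond -!big_split /= big_seq [RHS]big_seq.
  apply: eq_bigr => -[u v]; rewrite mem_qsols // => /andP[h _]; exact: sg5_fix.
- exact: sg5_sols.
- exact: sg5_inv.
Qed.

(** In use, [phi] is multiplication by an element of norm 9 in Z[sqrt(-a)]; it maps all solutions
    for M / 9 onto the class that the involution leaves fixed. *)
Lemma qcount_desc a (C : int -> int -> bool) (phi : int * int -> int * int) (e : int) M :
  (0 < a)%N -> injective phi ->
  (forall u v, ((phi (u, v)).1 ^+ 2 + a%:Z * (phi (u, v)).2 ^+ 2 = 9 * (u ^+ 2 + a%:Z * v ^+ 2))) ->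
  (forall u v, C u v -> C (phi (u, v)).1 (phi (u, v)).2 && desc e (phi (u, v))) ->
  (forall x y, C x y -> desc e (x, y) -> exists u v, C u v /\ (x, y) = phi (u, v)) ->
  \sum_(p <- qsols a C M | desc e p) 1 = dil 9 (qcount a C) M.
Proof.
move=> a0 inj hq hC hsurj; rewrite sum_F2 dilE; case: ifP => [/dvdnP[N eM]|ndiv].
  rewrite eM mulnK // -eM -[RHS]/((size (qsols a C N))%:R) -(size_map phi (qsols a C N)).
  congr (_%:R); apply: (@perm_size (int * int)%type).
  apply: uniq_perm => [||[x y]]; first by rewrite filter_uniq // qsols_uniq.
    by rewrite map_inj_uniq // qsols_uniq.
  rewrite mem_filter mem_qsols //; apply/and3P/mapP.
    move=> [dxy Cxy /eqP q]; have [u [v [Cuv exy]]] := hsurj x y Cxy dxy.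
    exists (u, v) => //; rewrite mem_qsols // Cuv /=; apply/eqP.
    by have := hq u v; rewrite -exy /= q eM; lia.
  move=> [[u v]]; rewrite mem_qsols // => /andP[Cuv /eqP q] exy.
  have := hC u v Cuv; have := hq u v; rewrite -exy /= => h /andP[h1 h2].
  by split=> //; apply/eqP; rewrite h q eM; lia.
rewrite (_ : [seq _ <- _ | _] = [::]) //; apply/eqP; rewrite -[_ == _]negbK -has_filter.
apply/hasPn => -[x y]; rewrite mem_qsols // => /andP[Cxy /eqP q]; apply/negP => dxy.
have [u [v [Cuv exy]]] := hsurj x y Cxy dxy.
have := hq u v; rewrite -exy /= q => h; move/negP: ndiv; apply.
by apply/dvdnP; exists `|(u ^+ 2 + a%:Z * v ^+ 2)%R|%N; move: h; lia.
Qed.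

Lemma qcount5_rec : qcount 5 C5 = eta + dil 5 eta + dil 9 (qcount 5 C5).
Proof.
apply: seriesP => M; rewrite qcount_sg5 !serD; congr (_ + _ + _).
- apply: sum1_le1; first exact: qsols_uniq.
    move=> [u v] [u' v']; rewrite !mem_qsols // /C5 => /andP[/eqP h /eqP q].
    move=> /andP[/eqP h' /eqP q'] /= /eqP v0 /eqP v0'.
    move: h q h' q'; rewrite v0 v0' !addr0 => h <- h' /eqP.
    by rewrite eqf_sqr => /orP[/eqP -> //|/eqP e]; lia.
  rewrite etaP; split=> [[x x5 ex]|[[u v]]].
    by exists (x, 0) => //; rewrite mem_qsols // /C5 addr0 x5 eqxx ex /= addr0.
  rewrite mem_qsols // /C5 => /andP[/eqP h /eqP q] /= /eqP v0; move: h q.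
  by rewrite v0 !addr0 => h q; exists u.
- apply: sum1_le1; first exact: qsols_uniq.
    move=> [u v] [u' v']; rewrite !mem_qsols // /C5 => /andP[/eqP h /eqP q].
    move=> /andP[/eqP h' /eqP q'] /= /eqP v0 /eqP v0'.
    move: h q h' q'; rewrite v0 v0' !add0r => h q h' q'.
    have /eqP : v' ^+ 2 = v ^+ 2 by lia.
    by rewrite eqf_sqr => /orP[/eqP -> //|/eqP e]; lia.
  rewrite dilE; split=> [|[[u v]]].
    case: ifP => // /dvdnP[m ->]; rewrite mulnK // => /etaP[x x5 ex].
    exists (0, x) => //; rewrite mem_qsols // /C5 add0r x5 eqxx ex add0r.
    by apply/eqP; lia.
  rewrite mem_qsols // /C5 => /andP[/eqP h /eqP q] /= /eqP u0; move: h q.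
  rewrite u0 !add0r => h q.
  have eM : (M = `|v ^+ 2| * 5)%N by have := sqr_ge0 v; lia.
  rewrite eM dvdn_mull // mulnK //; apply/etaP; exists v => //.
  by rewrite gez0_abs ?sqr_ge0.
(* Multiplication of u + v sqrt(-5) by 2 - sqrt(-5). *)
- apply: (@qcount_desc _ _ (fun p => (2 * p.1 + 5 * p.2, 2 * p.2 - p.1))) => //=.
  + by move=> [u v] [u' v'] /= [e1 e2]; congr (_, _); lia.
  + by move=> u v; ring.
  + by move=> u v; rewrite /C5 /desc /=; lia.
  + move=> x y; rewrite /C5 /desc /=; set t := ((x - y) %/ 3)%Z => /eqP h1 /andP[/eqP h2 /eqP h3].
    have et : x = y + 3 * t by rewrite /t; lia.
    exists (t - ((y + t) %/ 3)%Z), ((y + t) %/ 3)%Z; split; first lia.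
    by congr (_, _); lia.
Qed.

Lemma sg2_sols M : {in qsols 2 C2 M, forall p, sg2 p \in qsols 2 C2 M}.
Proof.
move=> [u v]; rewrite mem_qsols // /C2 /C5 => /andP[/andP[/eqP h /eqP k] /eqP e]; rewrite /sg2.
case: eqP => h0; first by rewrite mem_qsols // /C2 /C5 -e sqrrN eqxx andbT; lia.
case: eqP => h1; first by rewrite mem_qsols // /C2 /C5 -e sqrrN eqxx andbT; lia.
set t := ((u - v) %/ 3)%Z; have eu : u = v + 3 * t by rewrite /t; lia.
case: eqP => h2.
  rewrite mem_qsols // /C2 /C5 -e; apply/andP; split; first by lia.
  by apply/eqP; rewrite eu; ring.
case: eqP => h3.
  rewrite mem_qsols // /C2 /C5 -e; apply/andP; split; first by lia.
  by apply/eqP; rewrite eu; ring.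
by rewrite mem_qsols // /C2 /C5 h k e !eqxx.
Qed.

Lemma sg2_inv M : {in qsols 2 C2 M, forall p, sg2 (sg2 p) = p}.
Proof.
move=> [u v]; rewrite mem_qsols // /C2 /C5 => /andP[/andP[/eqP h /eqP k] _]; rewrite /sg2.
case: (eqVneq (v %% 3)%Z 0) => h0; first by rewrite ifT ?opprK //; lia.
case: (eqVneq (v %% 3)%Z 2) => h1; first by rewrite (negbTE h0) h1 ?opprK.
set t := ((u - v) %/ 3)%Z; have eu : u = v + 3 * t by rewrite /t; lia.
case: (eqVneq (t %% 3)%Z 0) => h2.
  have et : ((v - t - (v + 2 * t)) %/ 3 = - t)%Z by lia.
  have e1 : ((v + 2 * t) %% 3)%Z = 1 by lia.
  have e2 : ((- t) %% 3)%Z = 0 by lia.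
  by rewrite et e1 e2 /=; congr (_, _); lia.
case: (eqVneq (t %% 3)%Z 2) => h3.
  have et : ((t - v - (- v - 2 * t)) %/ 3 = t)%Z by lia.
  have e1 : ((- v - 2 * t) %% 3)%Z = 1 by lia.
  by rewrite et e1 h3 /=; congr (_, _); lia.
by rewrite (negbTE h0) (negbTE h1) -/t (negbTE h2) (negbTE h3).
Qed.

Lemma sg2_fix u v : C2 u v ->
  (if sg2 (u, v) == (u, v) then 1 else 0) =
  (if v == 0 then 1 else 0) + (if desc 1 (u, v) then 1 else 0) :> 'F_2.
Proof.
rewrite /C2 /C5 /sg2 /desc /= => /andP[/eqP h /eqP k].
set t := ((u - v) %/ 3)%Z.
have -> : ((if (v %% 3)%Z == 0 then (u, - v)
  else if (v %% 3)%Z == 2 then (- u, v)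
  else if (t %% 3)%Z == 0 then (v - t, v + 2 * t)
  else if (t %% 3)%Z == 2 then (t - v, - v - 2 * t) else (u, v)) == (u, v)) =
  ((v == 0) || ((v %% 3)%Z == 1) && ((t %% 3)%Z == 1)).
  do 4?case: ifP => ?; rewrite xpair_eqE; lia.
have : ~~ ((v == 0) && (((v %% 3)%Z == 1) && ((t %% 3)%Z == 1))) by lia.
by case: (v == 0); case: ((v %% 3)%Z == 1); case: ((t %% 3)%Z == 1) => // _; rewrite ?addr0 ?add0r.
Qed.

Lemma qcount_sg2 M : qcount 2 C2 M =
  \sum_(p <- qsols 2 C2 M | p.2 == 0) 1 + \sum_(p <- qsols 2 C2 M | desc 1 p) 1.
Proof.
rewrite -[LHS]/((size (qsols 2 C2 M))%:R) -[size _](count_predT) -size_filter -sum_F2.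
rewrite (sum_invol char2_F2 (sg := sg2)) ?qsols_uniq //.
- rewrite big_mkcond [X in _ = X + _]big_mkcond [X in _ = _ + X]big_mkcond.
  rewrite -!big_split /= big_seq [RHS]big_seq.
  apply: eq_bigr => -[u v]; rewrite mem_qsols // => /andP[h _]; exact: sg2_fix.
- exact: sg2_sols.
- exact: sg2_inv.
Qed.

Lemma qcount2_rec : qcount 2 C2 = eta + dil 9 (qcount 2 C2).
Proof.
apply: seriesP => M; rewrite qcount_sg2 !serD; congr (_ + _).
- apply: sum1_le1; first exact: qsols_uniq.
    move=> [u v] [u' v']; rewrite !mem_qsols // /C2 /C5 => /andP[/andP[/eqP h _] /eqP q].
    move=> /andP[/andP[/eqP h' _] /eqP q'] /= /eqP v0 /eqP v0'.
    move: h q h' q'; rewrite v0 v0' !addr0 => h <- h' /eqP.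
    by rewrite eqf_sqr => /orP[/eqP -> //|/eqP e]; lia.
  rewrite etaP; split=> [[x x5 ex]|[[u v]]].
    by exists (x, 0) => //; rewrite mem_qsols // /C2 /C5 addr0 x5 eqxx ex /= addr0.
  rewrite mem_qsols // /C2 /C5 => /andP[/andP[/eqP h _] /eqP q] /= /eqP v0; move: h q.
  by rewrite v0 !addr0 => h q; exists u.
(* Multiplication of u + v sqrt(-2) by -1 + 2 sqrt(-2). *)
- apply: (@qcount_desc _ _ (fun p => (- p.1 - 4 * p.2, 2 * p.1 - p.2))) => //=.
  + by move=> [u v] [u' v'] /= [e1 e2]; congr (_, _); lia.
  + by move=> u v; ring.
  + by move=> u v; rewrite /C2 /C5 /desc /=; lia.
  + move=> x y; rewrite /C2 /C5 /desc /=; set t := ((x - y) %/ 3)%Z.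
    move=> /andP[/eqP h1 /eqP h4] /andP[/eqP h2 /eqP h3].
    have et : x = y + 3 * t by rewrite /t; lia.
    exists ((y - t) %/ 3)%Z, (- t - ((y - t) %/ 3)%Z); split; first lia.
    by congr (_, _); lia.
Qed.

Lemma theta_rec : theta = eta + dil 9 theta.
Proof.
apply: seriesP => n; rewrite serD dilE.
case: ifP => [/dvdnP[m en]|ndiv].
  have -> : eta n = 0.
    case: (F2P (eta n)) => // /sqind_eq1[x]; rewrite coprime6P en => /andP[_ x3] e.
    by case/negP: x3; rewrite -dvd_sqr // -e; lia.
  rewrite add0r en mulnK //; apply: eq_F2; rewrite !sqind_eq1; split=> -[x ox e].
    have /dvdnP[y ey] : (3 %| x)%N by rewrite -dvd_sqr // -e; lia.
    exists y; first by move: ox; rewrite ey oddM => /andP[].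
    by move: e; rewrite ey expnMn; lia.
  by exists (3 * x)%N; [rewrite oddM | rewrite e expnMn; lia].
rewrite addr0; apply: eq_F2; rewrite !sqind_eq1; split=> -[x ox e]; exists x => //.
  rewrite coprime6P ox; apply/negP => /dvdnP[y ey].
  by move/negP: ndiv; apply; rewrite e ey expnMn dvdn_mull.
by move: ox; rewrite coprime6P => /andP[].
Qed.

(** Uniqueness for f = g + f(q^9) with zero constant term; the counts are identified with theta
    series through it. *)
Lemma dil9_fixed (a : series) : a 0%N = 0 -> a = dil 9 a -> a = 0.
Proof.
move=> a0 e; apply: seriesP => n; elim/ltn_ind: n => n IH.
rewrite e dilE; case: ifP => // /dvdnP[m em]; rewrite em mulnK //.
by case: m em => [//|m] em; rewrite IH // em; lia.
Qed.

Lemma qcount0 a C : (0 < a)%N -> C 0 0 = false -> qcount a C 0%N = 0.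
Proof.
move=> a0 C0; rewrite /qcount /=; case pent: (qsols a C 0) => [//|[x y] s].
have : (x, y) \in qsols a C 0 by rewrite pent mem_head.
rewrite mem_qsols // => /andP[Cxy /eqP q].
have x0 : x = 0 by nia. have y0 : y = 0 by nia.
by move: Cxy; rewrite x0 y0 C0.
Qed.

Lemma qcount2 : qcount 2 C2 = theta.
Proof.
apply: (eq_mod2 char2_series (z := 0)); rewrite addr0.
apply: dil9_fixed; first by rewrite serD qcount0 // theta0 addr0.
by rewrite dilD {1}qcount2_rec {1}theta_rec addrACA (addrr_pchar2 char2_series) add0r.
Qed.

Lemma qcount5 : qcount 5 C5 = theta + dil 5 theta.
Proof.
apply: (eq_mod2 char2_series (z := 0)); rewrite addr0.
have v0 : dil 5 theta 0%N = 0 by exact: theta0.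
apply: dil9_fixed; first by rewrite !serD qcount0 // v0 theta0 !addr0.
rewrite {1}qcount5_rec {1 2}theta_rec !dilD !dil_dil //.
rewrite -[(5 * 9)%N]/45%N -[(9 * 5)%N]/45%N; move: (dil 9 _) => K.
apply: (eq_mod2 char2_series (z := eta + dil 5 eta + K + dil 9 theta + dil 45 theta)).
by ring.
Qed.

(** Cubing eta(q) eta(q^5) = (theta + theta')(q^3)^2 and applying eta^3 = theta(q^3) gives the
    equation with q^3 in place of q. *)
Theorem modular_equation : theta * theta5 = (theta + theta5) ^+ 6.
Proof.
have e3 : eta ^+ 3 = dil 3 theta by rewrite exprS sqr_dil conv2 qcount2.
have e5 : eta * dil 5 eta = (dil 3 (theta + theta5)) ^+ 2.
  by rewrite conv5 qcount5 sqr_dil dil_dil.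
apply: (dil_inj (p := 3)) => //.
rewrite dilX // (exprM _ 2 3) -e5 exprMn e3 -dilX // e3 dilM //.
by rewrite !dil_dil.
Qed.

(** * The Hecke operator at 5 *)

Lemma pow6 (R : comNzRingType) (ch : 2%N \in [pchar R]) (x y : R) :
  (x + y) ^+ 6 = x ^+ 6 + y ^+ 2 * x ^+ 4 + y ^+ 4 * x ^+ 2 + y ^+ 6.
Proof.
rewrite (exprM _ 2 3) (sqrD2 ch).
by apply: (eq_mod2 ch (z := x ^+ 6 + 2 * x ^+ 4 * y ^+ 2 + 2 * x ^+ 2 * y ^+ 4 + y ^+ 6)); ring.
Qed.

Lemma modeq_pow6 (R : comNzRingType) (ch : 2%N \in [pchar R]) (x y : R) : x * y = (x + y) ^+ 6 ->
  x ^+ 6 = y ^+ 2 * x ^+ 4 + y ^+ 4 * x ^+ 2 + y * x + y ^+ 6.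
Proof.
rewrite (pow6 ch) mulrC => ->.
apply: (eq_mod2 ch (z := x ^+ 6 + y ^+ 2 * x ^+ 4 + y ^+ 4 * x ^+ 2 + y ^+ 6)).
by ring.
Qed.

Lemma tpow_rec i k : tpow i (k + 6) =
  'X^2 * tpow i (k + 4) + 'X^4 * tpow i (k + 2) + 'X * tpow i (k + 1) + 'X^6 * tpow i k.
Proof.
have eXY : Xd * Yd = (Xd + Yd) ^+ 6 :> A.
  have -> : Xd + Yd = 'X * ('X + 1) :> A.
    apply: (eq_mod2 char2_poly (z := 'X^6 + 3 * 'X^5 + 5 * 'X^4 + 5 * 'X^3 + 3 * 'X^2 + 'X)).
    by rewrite /Xd /Yd; ring.
  by rewrite /Xd /Yd; ring.
have TauYn n P : 'X^n * Tau P = Tau (Yd ^+ n * P).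
  by elim: n => [|n IH]; rewrite ?mul1r // !exprS -!mulrA IH Tau_Y.
rewrite /tpow -['X * Tau _]/('X^1 * Tau _) !TauYn -!linearD /= !exprD (modeq_pow6 char2_poly eXY).
by congr Tau; ring.
Qed.

Definition sumTU (k : nat) : series := sec5 (theta ^+ k) + theta5 ^+ k.

Lemma sec5_theta5M j (a : series) : sec5 (theta5 ^+ j * a) = theta ^+ j * sec5 a.
Proof. by rewrite /theta5 -dilX // sec5_dilM. Qed.

(** The modular equation is symmetric: solved for theta^6 its coefficients are powers of theta',
    which leave [sec5] as powers of theta; solved for theta'^6 they are powers of theta already. *)
Lemma sumTU_rec k : sumTU (k + 6) =
  theta ^+ 2 * sumTU (k + 4) + theta ^+ 4 * sumTU (k + 2) + theta * sumTU (k + 1) +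
  theta ^+ 6 * sumTU k.
Proof.
have modeq' : theta5 * theta = (theta5 + theta) ^+ 6 by rewrite mulrC addrC; exact: modular_equation.
have -> : sumTU (k + 6) = sec5 (theta5 ^+ 2 * theta ^+ (k + 4) + theta5 ^+ 4 * theta ^+ (k + 2) +
    theta5 ^+ 1 * theta ^+ (k + 1) + theta5 ^+ 6 * theta ^+ k) +
    (theta ^+ 2 * theta5 ^+ (k + 4) + theta ^+ 4 * theta5 ^+ (k + 2) + theta * theta5 ^+ (k + 1) +
      theta ^+ 6 * theta5 ^+ k).
  rewrite /sumTU; congr (sec5 _ + _); rewrite !exprD.
    by rewrite (modeq_pow6 char2_series modular_equation); ring.
  by rewrite (modeq_pow6 char2_series modeq'); ring.
by rewrite !sec5D !sec5_theta5M expr1 /sumTU; ring.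
Qed.

Lemma sumTU_sqr k : sumTU (k * 2) = sumTU k ^+ 2.
Proof. by rewrite /sumTU !exprM sec5_sqr (sqrD2 char2_series). Qed.

Lemma sumTU_small :
  ((sumTU 0 = 0) * (sumTU 1 = 0) * (sumTU 2 = 0) * (sumTU 3 = 0) * (sumTU 4 = 0))%type.
Proof.
have addss (a : series) : a + a = 0 by rewrite (addrr_pchar2 char2_series).
have L1 : sumTU 1 = 0 by rewrite /sumTU !expr1 sec5_theta addss.
have L2 : sumTU 2 = 0 by rewrite (sumTU_sqr 1) L1 expr0n.
by rewrite (sumTU_sqr 2) L2 L1 {1 2}/sumTU !expr0 sec5_1 sec5_theta3 !addss expr0n.
Qed.

Lemma sumTU5_neq0 : sumTU 5 <> 0.
Proof.
move=> /(congr1 (fun a : series => a 1%N)); rewrite /sumTU serD ser0E.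
have pow5 (a : series) : a ^+ 5 = a * dil 2 (dil 2 a) by rewrite -!sqr_dil -exprM -exprS.
have c5 (a : series) : a 0%N = 0 -> (a ^+ 5) 5%N = a 1%N.
  rewrite pow5 serM !big_ord_recl big_ord0 /= => ->.
  by rewrite !mulr0 !add0r !addr0; case: (F2P (a 1%N)) => ->; rewrite ?mulr0 ?mulr1.
have c1 (a : series) : a 0%N = 0 -> (a ^+ 5) 1%N = 0.
  by rewrite pow5 serM !big_ord_recl big_ord0 /= => ->; rewrite !mul0r !mulr0 !addr0.
have -> : sec5 (theta ^+ 5) 1%N = 1 by exact: etrans (c5 theta theta0) theta1.
have -> : (theta5 ^+ 5) 1%N = 0 by apply: c1; exact: theta0.
by rewrite addr0 => /eqP; rewrite oner_eq0.
Qed.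

(* The recurrence at k = 4 reads (sumTU 5)^2 = theta * sumTU 5. *)
Lemma sumTU5 : sumTU 5 = theta.
Proof.
have /eqP := sumTU_rec 4.
rewrite (sumTU_sqr 5) (sumTU_sqr 3) (sumTU_sqr 4) !sumTU_small expr0n !mulr0 !add0r addr0.
rewrite expr2 -subr_eq0 -mulrBl => /eqP /series_mulf_eq0[/eqP|/sumTU5_neq0 //].
by rewrite subr_eq0 => /eqP.
Qed.

Definition sconst (c : 'F_2) : series := Series (fun n => if n is 0 then c else 0).

Fact sconst_is_zmod_morphism : zmod_morphism sconst.
Proof. by move=> a b; apply: seriesP => -[|n]; rewrite ?serD //= subr0. Qed.
Fact sconst_is_monoid_morphism : monoid_morphism sconst.
Proof.
split; first by apply: seriesP => -[|n].
move=> a b; apply: seriesP => -[|n]; rewrite serM big_ord_recl /=; first by rewrite big_ord0 addr0.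
by rewrite mulr0 add0r big1 // => i _; rewrite mul0r.
Qed.
HB.instance Definition _ := GRing.isZmodMorphism.Build 'F_2 series sconst sconst_is_zmod_morphism.
HB.instance Definition _ := GRing.isMonoidMorphism.Build 'F_2 series sconst sconst_is_monoid_morphism.

Definition ev (P : A) : series := (map_poly sconst P).[theta].

Lemma evD P Q : ev (P + Q) = ev P + ev Q.
Proof. by rewrite /ev rmorphD hornerD. Qed.

Lemma evM P Q : ev (P * Q) = ev P * ev Q.
Proof. by rewrite /ev rmorphM hornerM. Qed.

Lemma ev0 : ev 0 = 0.
Proof. by rewrite /ev rmorph0 horner0. Qed.

Lemma evXn n : ev 'X^n = theta ^+ n.
Proof. by rewrite /ev map_polyXn hornerXn. Qed.

Lemma evX : ev 'X = theta.
Proof. by rewrite -['X]expr1 evXn. Qed.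

Lemma evXnM n P : ev ('X^n * P) = theta ^+ n * ev P.
Proof. by rewrite evM evXn. Qed.

Definition hecke5 (a : series) : series := sec5 a + dil 5 a.

Lemma hecke5_0 : hecke5 0 = 0.
Proof. by rewrite /hecke5; apply: seriesP => n; rewrite serD dilE ser0E /=; case: ifP; rewrite addr0. Qed.

Lemma tpow4_small :
  ((tpow 4 0 = 0) * (tpow 4 1 = 0) * (tpow 4 2 = 0) *
   (tpow 4 3 = 0) * (tpow 4 4 = 0) * (tpow 4 5 = 'X))%type.
Proof.
have tT k : tpow 4 k = opT 'X^k by rewrite /opT trop_Xn.
have sq k : tpow 4 (k * 2) = tpow 4 k ^+ 2.
  have e : 'X^4 * Xd ^+ (k * 2) = ('X^2 * Xd ^+ k) ^+ 2 by rewrite exprM; ring.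
  by rewrite /tpow e Tau_sqr (mulrA 'X^2) -exprD.
have e0 : tpow 4 0 = 0 by rewrite /tpow mulr1 Tau_Xn tau_small.
have e1 : tpow 4 1 = 0.
  rewrite tT expr1 -['X]mulr1 -(expr1n _ 2) opT_mulXsqr /opS2 /trop rmorph1 mulr1.
  by rewrite linearD /= !Tau_Xn !tau_small addr0 expr0n mulr0.
have e2 : tpow 4 2 = 0 by rewrite (sq 1) e1 expr0n.
have e3 : tpow 4 3 = 0.
  rewrite tT exprS opT_mulXsqr /opS2 -['X]expr1 trop_Xn.
  have -> : ('X^2 + 'X^4) * Xd ^+ 1 =
    'X^3 + 'X^4 + 'X^7 + 'X^8 + ('X^5 + 'X^6 + 'X^9 + 'X^10) :> A by rewrite XdE; ring.
  rewrite !linearD /= !Tau_Xn !tau_small !add0r -!addrA !addKr_pchar2 ?char2_poly //.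
  by rewrite (addrr_pchar2 char2_poly) expr0n mulr0.
by rewrite e0 e1 e2 e3 (sq 2) e2 expr0n tT opT_X5.
Qed.

(** Both sides obey the same recurrence of order six and share the first six values. *)
Lemma sumTU_ev k : sumTU k = ev (tpow 4 k).
Proof.
elim/ltn_ind: k => k IH.
case: k IH => [|[|[|[|[|[|k]]]]]] IH; rewrite ?tpow4_small ?sumTU_small ?sumTU5 ?ev0 ?evX //.
rewrite -[k.+1.+1.+4]/(6 + k)%N addnC tpow_rec sumTU_rec // !evD !evXnM evM evX !IH //; lia.
Qed.

Lemma hecke5_ev P : hecke5 (ev P) = ev (opT P).
Proof.
elim/poly_ind_lin: P => [|k|P Q IP IQ].
- by rewrite /opT linear0 ev0 hecke5_0.
- by rewrite /opT trop_Xn -/(tpow _ _) -sumTU_ev evXn /hecke5 dilX.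
- rewrite /opT linearD /= -/opT !evD -IP -IQ /hecke5 dilD sec5D.
  by ring.
Qed.

Lemma iter_hecke5_theta s : iter (2 ^ s - 1) hecke5 (theta ^+ kexp s) = theta.
Proof.
have it n P : iter n hecke5 (ev P) = ev (iter n opT P).
  by elim: n => //= n ->; rewrite hecke5_ev.
by rewrite -evXn it iter_opT_kexp evX.
Qed.

(** * Hecke operators at powers of 5 *)

Definition sec5_iter (m : nat) (a : series) := Series (fun n => a (5 ^ m * n)%N).

Lemma sec5_sec5_iter m a : sec5 (sec5_iter m a) = sec5_iter m.+1 a.
Proof. by apply: seriesP => n; rewrite /= mulnA -expnSr. Qed.

(* [Dseq a m] is the image of a under the Hecke operator at 5^m. *)
Fixpoint Dseq (a : series) (m : nat) : series :=
  if m is m'.+1 then sec5_iter m a + dil 5 (Dseq a m') else a.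

Lemma DseqS a m : Dseq a m.+1 = sec5_iter m.+1 a + dil 5 (Dseq a m).
Proof. by []. Qed.

Lemma hecke5_Dseq a m : hecke5 (Dseq a m.+1) = Dseq a m.+2 + Dseq a m.
Proof. by rewrite (DseqS a m.+1) /hecke5 [in sec5 _]DseqS sec5D sec5K sec5_sec5_iter addrAC. Qed.

Lemma hecke5D (a b : series) : hecke5 (a + b) = hecke5 a + hecke5 b.
Proof. by rewrite /hecke5 dilD sec5D; ring. Qed.

(** Shifted by one so that E_0 = 0 and T E_m = E_(m+1) + E_(m-1) from m = 1 on, as for Chebyshev
    polynomials of the second kind. *)
Definition Eseq (a : series) (m : nat) : series := if m is m'.+1 then Dseq a m' else 0.

Lemma EseqE a m : (0 < m)%N -> Eseq a m = Dseq a (m - 1).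
Proof. by case: m => // m _; rewrite subn1. Qed.

(* Chebyshev doubling: the middle terms cancel in characteristic 2. *)
Lemma iter_hecke5_Eseq (a : series) j m : (2 ^ j <= m)%N ->
  iter (2 ^ j) hecke5 (Eseq a m) = Eseq a (m + 2 ^ j) + Eseq a (m - 2 ^ j).
Proof.
have iD n x y : iter n hecke5 (x + y) = iter n hecke5 x + iter n hecke5 y.
  by elim: n => //= n ->; rewrite hecke5D.
elim: j m => [|j IH] m le.
  rewrite expn0 addn1 subn1 /=; case: m le => [|[|m]] //= _.
    rewrite addr0 /hecke5; congr (_ + _).
  exact: hecke5_Dseq.
rewrite expnS in le; rewrite expnS mul2n -addnn iterD IH; last by lia.
rewrite iD !IH; try lia.
have e1 : (m + 2 ^ j - 2 ^ j = m)%N by lia.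
have e2 : (m - 2 ^ j + 2 ^ j = m)%N by lia.
rewrite e1 e2 addrA -[X in X + _]addrA (addrr_pchar2 char2_series) addr0.
by congr (Eseq a _ + Eseq a _); lia.
Qed.

Lemma iter_hecke5_coef (a : series) j n : ~~ (5 %| n)%N ->
  iter (2 ^ j - 1) hecke5 a n = a (5 ^ (2 ^ j - 1) * n)%N.
Proof.
move=> n5; have -> : iter (2 ^ j - 1) hecke5 a = Dseq a (2 ^ j - 1).
  elim: j => [|j IH]; first by [].
  have p0 := expn_gt0 2 j.
  have -> : (2 ^ j.+1 - 1 = 2 ^ j + (2 ^ j - 1))%N by rewrite expnS; lia.
  (* Taking m = 2^j turns the second term into E_0 = 0. *)
  rewrite iterD IH -EseqE // (iter_hecke5_Eseq a (leqnn _)) subnn addr0 EseqE ?addn_gt0 ?p0 //.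
  by congr (Dseq a _); lia.
(* The dilated part of [Dseq] vanishes at n, which is prime to 5. *)
case: (2 ^ j - 1)%N => [|m]; first by rewrite mul1n.
by rewrite [LHS]/= (negbTE n5) addr0.
Qed.

(** * The pentagonal number theorem modulo 2 *)

Definition tri (j : nat) : nat := 'C(j.+1, 2).

Lemma triS j : tri j.+1 = (tri j + j.+1)%N.
Proof. by rewrite /tri binS bin1. Qed.

Lemma triE j : (2 * tri j = j * j.+1)%N.
Proof. by elim: j => [|j IH]; rewrite ?muln0 // triS mulnDr IH; lia. Qed.

Section Shanks.
Variables (R : comNzRingType) (ch : 2%N \in [pchar R]) (q : R).

Definition poch_from (j n : nat) : R := \prod_(j <= i < n) (1 + q ^+ i.+1).

Definition shanks_term (n j : nat) : R := poch_from j n * q ^+ (j * n + tri j).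

(* Shanks's finite form of the pentagonal number theorem, without signs; the
   exponents on the right are (j+1)(3(j+1) -+ 1)/2. *)
Lemma shanks n :
  \sum_(j < n.+1) shanks_term n j =
  1 + \sum_(j < n) (q ^+ (j.+1 ^ 2 + tri j) + q ^+ (j.+1 ^ 2 + tri j.+1)).
Proof.
elim: n => [|n IH].
  by rewrite big_ord_recl !big_ord0 /shanks_term /poch_from big_geq // mulr1.
rewrite (big_ord_recr n) /= addrA -IH big_ord_recr /=.
(* From n to n + 1 the term j gains c j and c (j - 1); over the whole sum every c cancels in pairs
   except c n. *)
pose c j := shanks_term n j * q ^+ (j + n.+1).
pose b j := if j is j'.+1 then c j' else 0.
have step j : (j <= n)%N -> shanks_term n.+1 j = shanks_term n j + b j + c j.
  move=> jn; have e1 : shanks_term n.+1 j = shanks_term n j * q ^+ j + c j.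
    rewrite /c /shanks_term /poch_from big_nat_recr //=.
    have -> : (j * n.+1 + tri j = j * n + tri j + j)%N by lia.
    by rewrite !exprD; ring.
  rewrite e1; congr (_ + _); case: j jn {e1} => [|j] jn.
    by rewrite expr0 mulr1 addr0.
  have -> : b j.+1 = poch_from j n * q ^+ (j.+1 * n + tri j.+1).
    by rewrite /b /c /shanks_term -mulrA -exprD triS; congr (_ * q ^+ _); lia.
  rewrite /shanks_term /poch_from [\prod_(j <= i < n) _]big_ltn //.
  move: (\prod_(_ <= _ < _) _) (q ^+ (_ * n + _)) => P Z.
  by apply: (eq_mod2 ch (z := P * Z * q ^+ j.+1 + P * Z)); ring.
rewrite (eq_bigr (fun j : 'I_n.+1 => shanks_term n j + b j + c j)); last first.
  by move=> j _; rewrite step // -ltnS.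
rewrite !big_split /= [\sum_(i < n.+1) b i]big_ord_recl [\sum_(i < n.+1) c i]big_ord_recr /=.
rewrite (eq_bigr (fun i : 'I_n => c i)) //.
have -> : c n = q ^+ (n.+1 ^ 2 + tri n).
  by rewrite /c /shanks_term /poch_from big_geq // mul1r -exprD; congr (q ^+ _); lia.
have -> : shanks_term n.+1 n.+1 = q ^+ (n.+1 ^ 2 + tri n.+1).
  by rewrite /shanks_term /poch_from big_geq // mul1r; congr (q ^+ _); lia.
move: (\sum_(i < n.+1) _) (\sum_(i < n) _) (q ^+ _) (q ^+ _) => S G x y.
by apply: (eq_mod2 ch (z := S + G + x + y)); ring.
Qed.

Lemma poch0 n : poch_from 0 n = shanks_term n 0.
Proof. by rewrite /shanks_term mul0n mulr1. Qed.
End Shanks.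

Definition sX : series := Series (fun n => (n == 1)%:R).

Lemma sX_coef (a : series) n : (sX * a) n = if n is m.+1 then a m else 0.
Proof.
rewrite serM; case: n => [|n]; first by rewrite big_ord_recl big_ord0 /= mul0r addr0.
rewrite !big_ord_recl /= mul0r add0r mul1r big1 ?addr0 ?subn0 //.
  by congr (a _); rewrite /bump /=; lia.
by move=> i _; rewrite mul0r.
Qed.

Lemma sXn_coef k (a : series) n : (sX ^+ k * a) n = if (k <= n)%N then a (n - k)%N else 0.
Proof.
elim: k n => [|k IH] n; first by rewrite expr0 mul1r ?subn0.
by rewrite exprS -mulrA sX_coef; case: n => [//|n]; rewrite IH ltnS.
Qed.

Lemma sXn_coef1 k n : (sX ^+ k) n = (k == n)%:R.
Proof.
rewrite -[sX ^+ k]mulr1 sXn_coef ser1E; case: leqP => h; last by rewrite gtn_eqF.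
by congr (nat_of_bool _)%:R; lia.
Qed.

(** The pentagonal series: 24 n + 1 = (6 m - 1)^2 exactly when n = m (3 m - 1) / 2. *)
Definition pent : series := Series (fun n => eta (24 * n + 1)%N).

Lemma eta_pent : eta = sX * dil 24 pent.
Proof.
apply: seriesP => n; rewrite -[sX]expr1 sXn_coef dilE.
case: n => [|n].
  by case: (F2P (eta 0%N)) => // /sqind_eq1[[|x]].
rewrite subn1 -[n.+1.-1]/n -[(1 <= n.+1)%N]/true; case: ifP => [/dvdnP[m ->]|ndiv].
  by rewrite mulnK // -[pent m]/(eta (24 * m + 1)%N); congr (eta _); lia.
case: (F2P (eta n.+1)) => // /sqind_eq1[x]; rewrite coprime6P => /andP[ox n3] e.
move/negP: ndiv; case; move: ox n3.
have x24 : x = (24 * (x %/ 24) + x %% 24)%N by rewrite mulnC -divn_eq.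
have := ltn_pmod x (isT : 0 < 24)%N.
move: (x %/ 24)%N (x %% 24)%N x24 e => k r -> e r24.
have : ((24 * k + r) ^ 2 = 24 * (24 * k ^ 2 + 2 * k * r) + r ^ 2)%N by ring.
rewrite -e; move: (24 * k ^ 2 + 2 * k * r)%N => K e' o3 n3.
have ok : all (fun r => odd r && ~~ (3 %| r) ==> (r ^ 2 %% 24 == 1))%N (iota 0 24) by [].
have := allP ok r; rewrite mem_iota r24 => /(_ isT).
have -> : odd r && ~~ (3 %| r)%N by lia.
by move=> /eqP; lia.
Qed.

Lemma ser_sum (I : Type) (r : seq I) (P : pred I) (F : I -> series) n :
  (\sum_(i <- r | P i) F i) n = \sum_(i <- r | P i) F i n.
Proof. by elim/big_rec2: _ => [//|i y x _ <-]; rewrite serD. Qed.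

(** Each step adds six integers to the range, of which 6 n + 5 and 6 n + 7 are prime to 6; their
    squares yield the two new exponents. *)
Lemma pent_sum n k :
  ((1 + \sum_(j < n) (sX ^+ (j.+1 ^ 2 + tri j) + sX ^+ (j.+1 ^ 2 + tri j.+1))) : series) k =
  \sum_(x <- iota 0 (6 * n + 2) | coprime x 6 && (x ^ 2 == 24 * k + 1)%N) 1.
Proof.
elim: n => [|n IH].
  rewrite big_ord0 addr0 ser1E !big_cons big_nil /=.
  by case: k => [|k] //=; rewrite ?addr0 // ifF //; lia.
have -> : (6 * n.+1 + 2 = (6 * n + 2) + 6)%N by lia.
rewrite big_ord_recr addrA serD IH serD !sXn_coef1 (iotaD 0 (6 * n + 2) 6) big_cat add0n.
move: (\sum_(x <- iota 0 _ | _) _) => Z; congr (Z + _); rewrite /=.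
rewrite !big_cons big_nil !coprime6P.
have -> : odd (6 * n + 2)%N = false by lia.
have -> : odd (6 * n + 2).+2%N = false by lia.
have -> : odd (6 * n + 2).+4%N = false by lia.
have -> : odd (6 * n + 2).+1%N && ~~ (3 %| (6 * n + 2).+1)%N = false by lia.
have -> : odd (6 * n + 2).+3%N && ~~ (3 %| (6 * n + 2).+3)%N by lia.
have -> : odd (6 * n + 2).+1.+4%N && ~~ (3 %| (6 * n + 2).+1.+4)%N by lia.
rewrite /= addr0.
have t1 := triE n; have t2 := triS n.
have e1 : ((6 * n + 2).+3 ^ 2 = 24 * (n.+1 ^ 2 + tri n) + 1)%N by nia.
have e2 : ((6 * n + 2).+1.+4 ^ 2 = 24 * (n.+1 ^ 2 + tri n.+1) + 1)%N by nia.
rewrite e1 e2 !eqn_add2r !eqn_pmul2l //.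
by case: (_ == k); case: (_ == k); rewrite /= ?addr0 ?add0r.
Qed.

Lemma pent_coef n k : (k <= n)%N -> pent k =
  \sum_(x <- iota 0 (6 * n + 2) | coprime x 6 && (x ^ 2 == 24 * k + 1)%N) 1.
Proof.
move=> kn; apply/esym/sum1_le1; first exact: iota_uniq.
  move=> x y _ _ /andP[_ /eqP ex] /andP[_ /eqP ey].
  by apply/eqP; rewrite -(@eqn_exp2r _ _ 2) // ex ey.
rewrite -[pent k]/(eta (24 * k + 1)%N) sqind_eq1; split=> [[x cx e]|[x _ /andP[cx /eqP e]]].
  by exists x; [rewrite mem_iota; nia | rewrite cx e eqxx].
by exists x.
Qed.

(** Shanks's terms with j > 0 start at degree j n + [tri j] > n, so only j = 0 is seen. *)
Lemma poch_coef n k : (k <= n)%N -> poch_from sX 0 n k = pent k.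
Proof.
move=> kn; rewrite (pent_coef kn) -pent_sum -(shanks char2_series) big_ord_recl -poch0 serD.
rewrite ser_sum big1 ?addr0 // => i _; rewrite /shanks_term mulrC sXn_coef ifF //.
apply/negbTE; rewrite -ltnNge -[nat_of_ord (lift _ _)]/(i.+1).
by have := triS i; have := leq_pmull n (ltn0Sn i); lia.
Qed.

(** * Partitions with bounded parts and their generating series *)

Definition parts (n : nat) : seq (seq nat) := sval (cid (npartP n)).

Lemma parts_uniq n : uniq (parts n).
Proof. by rewrite /parts; case: cid => ps []. Qed.

Lemma mem_parts n t : (t \in parts n) = is_partition n t.
Proof. by rewrite /parts; case: cid => ps []. Qed.

Lemma size_parts n : size (parts n) = npart n.
Proof. by rewrite /parts; case: cid => ps []. Qed.

Definition bparts (m n : nat) : seq (seq nat) := [seq t <- parts n | all (geq m) t].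

Lemma bparts_uniq m n : uniq (bparts m n).
Proof. by rewrite filter_uniq // parts_uniq. Qed.

Lemma mem_bparts m n t : (t \in bparts m n) = is_partition n t && all (geq m) t.
Proof. by rewrite mem_filter mem_parts andbC. Qed.

Lemma size_bparts m n : (n <= m)%N -> size (bparts m n) = npart n.
Proof.
move=> nm; rewrite -size_parts; congr size; apply/all_filterP/allP => t.
rewrite mem_parts => /and3P[_ _ /eqP s]; apply/allP => x xt /=.
apply: leq_trans nm; rewrite -s; elim: t xt {s} => //= y t IH.
by rewrite inE => /orP[/eqP->|/IH h]; [exact: leq_addr | exact: leq_trans h (leq_addl _ _)].
Qed.

Lemma size_bparts0 n : size (bparts 0 n) = (n == 0).
Proof.
case: n => [|n].
  have /perm_size -> // : perm_eq (bparts 0 0) [:: [::]].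
  apply: uniq_perm; rewrite ?bparts_uniq // => t; rewrite mem_bparts inE.
  case: t => [//|x t]; apply/negbTE/negP => /andP[/and3P[_ /andP[x0 _] _] /andP[/= xm _]].
  by lia.
apply/eqP; rewrite size_eq0; apply/eqP; case E: (bparts 0 n.+1) => [//|t s].
have : t \in bparts 0 n.+1 by rewrite E mem_head.
by rewrite mem_bparts; case: t {E} => [//|x t] /andP[/and3P[_ /andP[x0 _] _] /andP[/= xm _]]; lia.
Qed.

(** A nonincreasing sequence bounded by m + 1 either starts with m + 1 or is bounded by m. *)
Lemma size_bpartsS m n : size (bparts m.+1 n) =
  (size (bparts m n) + if (m.+1 <= n)%N then size (bparts m.+1 (n - m.+1)) else 0)%N.
Proof.
pose r := if (m.+1 <= n)%N then map (cons m.+1) (bparts m.+1 (n - m.+1)) else [::].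
have -> : (if (m.+1 <= n)%N then size (bparts m.+1 (n - m.+1)) else 0)%N = size r.
  by rewrite /r; case: ifP => //; rewrite size_map.
rewrite -size_cat; apply: perm_size; apply: uniq_perm.
- exact: bparts_uniq.
- rewrite cat_uniq bparts_uniq /=; apply/andP; split.
    apply/hasPn => t; rewrite /r; case: ifP => // _ /mapP[u _ ->].
    by rewrite mem_bparts /= ltnn !andbF.
  by rewrite /r; case: ifP => // _; rewrite map_inj_uniq ?bparts_uniq // => u v [].
move=> t; rewrite mem_cat !mem_bparts; apply/andP/orP.
  move=> [pt at1]; case: (boolP (all (geq m) t)) => am; first by left; rewrite pt.
  right; case: t pt at1 am => [//|x t] /and3P[/= st /andP[x0 pt] /eqP ex] /andP[xm atm] am.
  have ats : all (geq x) t by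
    rewrite path_sortedE in st; [case/andP: st | move=> a b c /= h1 h2; exact: leq_trans h2 h1].
  have ex1 : x = m.+1.
    apply/eqP; rewrite eqn_leq xm ltnNge; apply: contra am => xm'; rewrite xm' /=.
    by apply/allP => y /(allP ats) /= h; exact: leq_trans h xm'.
  subst x; rewrite /r ifT; last by lia.
  apply: map_f; rewrite mem_bparts /is_partition pt (path_sorted st) atm !andbT /=.
  by apply/eqP; lia.
case=> [/andP[pt am]|].
  by split=> //; apply: sub_all am => x /= h; lia.
rewrite /r; case: ifP => // le /mapP[u]; rewrite mem_bparts => /andP[/and3P[su pu /eqP eu] au] ->.
rewrite /is_partition /= pu ltnSn au eu subnKC // eqxx !andbT; split=> //.
by rewrite path_sortedE ?au ?su // => a b c /= h1 h2; exact: leq_trans h2 h1.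
Qed.

Definition bpart_gen (m : nat) : series := Series (fun n => (size (bparts m n))%:R).
Definition part_gen : series := Series (fun n => (npart n)%:R).

Lemma bpart_gen_poch m : bpart_gen m * poch_from sX 0 m = 1.
Proof.
elim: m => [|m IH].
  rewrite /poch_from big_geq // mulr1; apply: seriesP => n.
  by rewrite /= size_bparts0.
have e : bpart_gen m.+1 = bpart_gen m + sX ^+ m.+1 * bpart_gen m.+1.
  apply: seriesP => n; rewrite serD sXn_coef.
  by rewrite -[LHS]/((size (bparts m.+1 n))%:R) size_bpartsS natrD; case: ifP.
have e' : bpart_gen m.+1 * (1 + sX ^+ m.+1) = bpart_gen m.
  by rewrite mulrDr mulr1 [bpart_gen m.+1 * _]mulrC {1}e -addrA (addrr_pchar2 char2_series) addr0.
by rewrite /poch_from big_nat_recr //= -/(poch_from sX 0 m) mulrCA e' mulrC.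
Qed.

Lemma part_gen_pent : part_gen * pent = 1.
Proof.
apply: seriesP => n; rewrite -(bpart_gen_poch n) !serM; apply: eq_bigr => i _.
have := ltn_ord i => lt; rewrite poch_coef; last by lia.
by congr (_ * _); rewrite /= size_bparts // -ltnS.
Qed.

(** * From odd coefficients of theta powers to odd partition numbers *)

Lemma sqr_iter_dil (a : series) n : a ^+ (2 ^ n) = dil (2 ^ n) a.
Proof.
elim: n => [|n IH]; first by rewrite expr1; apply: seriesP => n; rewrite dilE dvd1n divn1.
by rewrite expnS mulnC exprM IH sqr_dil dil_dil ?expn_gt0 // mulnC.
Qed.

Lemma eta_cube : eta ^+ 3 = dil 3 theta.
Proof. by rewrite exprS sqr_dil conv2 qcount2. Qed.

Lemma kexpE r : (3 * kexp r + 1 = 4 ^ r.+1)%N.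
Proof. by elim: r => // r IH /=; rewrite expnS -IH; lia. Qed.

Lemma odd_F2 n : (n%:R != 0 :> 'F_2) = odd n.
Proof.
rewrite -[n in LHS]odd_double_half natrD -mul2n natrM.
have -> : 2%:R = 0 :> 'F_2 by apply: pchar_Fp_0.
by rewrite mul0r addr0; case: (odd n).
Qed.

Lemma theta_pow_coef r l : odd l -> ~~ (5 %| l)%N ->
  (theta ^+ kexp r) (5 ^ (2 ^ r - 1) * l ^ 2)%N = 1.
Proof.
move=> ol l5; have l25 : ~~ (5 %| l ^ 2)%N by rewrite (@dvd_sqr 5) //.
rewrite -iter_hecke5_coef // iter_hecke5_theta.
by apply/sqind_eq1; exists l.
Qed.

Lemma odd_part_exists r M : (theta ^+ kexp r) M = 1 ->
  exists i m, [/\ odd (npart i), eta (24 * m + 1)%N = 1 &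
    (M = 8 * (i + 4 ^ r.+1 * m) + kexp r)%N].
Proof.
move=> fM; set k := kexp r in fM *.
(* Cubing eta puts q^3 for q, hence the coefficient at 3 M. *)
have : (eta ^+ (3 * k)) (3 * M)%N = 1 by rewrite exprM eta_cube -dilX // dil_muln.
rewrite eta_pent exprMn -dilX // sXn_coef dilE; case: ifP => // kM.
case: ifP => // /dvdnP[N eN]; rewrite eN mulnK //.
have -> : pent ^+ (3 * k) = part_gen * dil (4 ^ r.+1) pent.
  have -> : (4 ^ r.+1 = 2 ^ (2 * r.+1))%N by rewrite expnM.
  rewrite -sqr_iter_dil expnM -kexpE addn1 exprS mulrA part_gen_pent mul1r //.
rewrite serM => h.
have [i hi] : exists i : 'I_N.+1, part_gen i * dil (4 ^ r.+1) pent (N - i)%N != 0.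
  apply: contrapT => hn; move: h; rewrite big1 => [/eqP|i _].
    by rewrite eq_sym oner_eq0.
  by apply/eqP/negPn/negP => h; apply: hn; exists i.
move: hi; rewrite mulf_eq0 negb_or dilE => /andP[Pi].
case: ifP => [/dvdnP[m em]|_]; last by rewrite eqxx.
rewrite em mulnK ?expn_gt0 // => Em; exists i, m; split.
- by rewrite -odd_F2.
- by rewrite -eta_pent; case: (F2P (pent m)) Em => [->|e _]; [rewrite eqxx | exact: e].
- by have := ltn_ord i; lia.
Qed.

Lemma pentagonal_eta m : eta (24 * m + 1)%N = 1 -> pentagonal m%:R.
Proof.
move=> /etaP[x x5 ex]; exists ((x + 1) %/ 6)%Z; set n := ((x + 1) %/ 6)%Z.
have xE : x = 6 * n - 1 by rewrite /n; lia.
have e : 2 * m%:Z = n * (3 * n - 1).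
  have : 12 * (2 * m%:Z) = 12 * (n * (3 * n - 1)).
    have -> : 12 * (2 * m%:Z) = (24 * m + 1)%N%:Z - 1 by lia.
    by rewrite -ex xE; ring.
  by lia.
have e2 : (2 * m%:Z)%:~R = (n * (3 * n - 1))%:~R :> rat by rewrite e.
have -> : (n%:~R * (3 * n%:~R - 1) : rat) = 2 * m%:R.
  by move: e2; rewrite !(rmorphM, rmorphB) /= => <-.
by field.
Qed.

Theorem theorem1p4 (s l : nat) (hs : (1 < s)%N)
    (hl0 : (0 < l)%N) (hl : odd l) (hl5 : ~~ (5 %| l)%N) :
  exists i : nat,
    [/\ odd i,
        (i <= 2 ^ (s - 1) - 1)%N &
        forall r : nat, (r <= s - 2)%N ->
          (2 ^ r)%N <> (2 ^ (s - 1) - i - 1)%N] /\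
    exists j : rat,
      pentagonal j /\
      odd (partq ((5 ^+ i * l%:R ^+ 2 - (4 ^+ s - 1) / 3) / 8 - 4 ^+ s * j)).
Proof.
case: s hs => [//|[//|r]] _; set h := (2 ^ r.+1 - 1)%N.
exists h; split.
  split=> // [|r' _]; first by rewrite /h expnS; have := expn_gt0 2 r; lia.
  (* The excluded powers of 2 are avoided because this value is 0. *)
  have -> : (2 ^ (r.+2 - 1) - h - 1 = 0)%N by rewrite /h -[(r.+2 - 1)%N]/(r.+1); lia.
  by have := expn_gt0 2 r'; lia.
have [i [m [oi em eM]]] := odd_part_exists (theta_pow_coef r.+1 hl hl5).
exists m%:R; split; first exact: pentagonal_eta.
have e1 : (5 ^+ h * l%:R ^+ 2 : rat) = 8 * (i%:R + 4 ^+ r.+2 * m%:R) + (kexp r.+1)%:R.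
  by rewrite -!natrX -!natrM -natrD -natrM -natrD -eM.
have e2 : (4 ^+ r.+2 : rat) = 3 * (kexp r.+1)%:R + 1.
  by rewrite -natrX -kexpE natrD natrM.
have -> : (5 ^+ h * l%:R ^+ 2 - (4 ^+ r.+2 - 1) / 3) / 8 - 4 ^+ r.+2 * m%:R = i%:R :> rat.
  by rewrite e1 e2; field.
by rewrite partq_nat.
Qed.
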